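(* Let $n,m\ge1$, $z=(z_1,\ldots,z_n)$ and $y=(y_1,\ldots,y_m)$, and let $\mathcal{P}$ be the set of all integer partitions. Then \begin{align*} \sum_{\lambda\in\mathcal{P}}\mathrm{sz}_\lambda(z)\,\mathrm{s}_\lambda(y) &=\prod_{j=1}^n\prod_{k=1}^m\frac{1}{1-z_jy_k+y_k^2},\\ \sum_{\lambda\in\mathcal{P}}\mathrm{sz}_\lambda(z)\,\mathrm{s}_{\lambda'}(y) &=\prod_{j=1}^n\prod_{k=1}^m\left(1+z_jy_k+y_k^2\right),\\ \sum_{\lambda\in\mathcal{P}}\mathrm{sz}_\lambda(z)\,\mathrm{sz}_{\lambda'}(y) &=\prod_{j=1}^n\prod_{k=1}^m(z_j+y_k)^2,\\ \sum_{\lambda\in\mathcal{P}}\mathrm{sz}^{\mathrm{odd}}_\lambda(z)\,\mathrm{s}_\lambda(y) &=\left(\prod_{j=1}^n\prod_{k=1}^m\frac{1}{1-z_jy_k+y_k^2}\right)\left(\prod_{k=1}^m\frac{1}{1-y_k}\right),\\ \sum_{\lambda\in\mathcal{P}}\mathrm{sz}^{\mathrm{odd}}_\lambda(z)\,\mathrm{s}_{\lambda'}(y) &=\left(\prod_{j=1}^n\prod_{k=1}^m(1+z_jy_k+y_k^2)\right)\left(\prod_{k=1}^m(1+y_k)\right),\\ \sum_{\lambda\in\mathcal{P}}\mathrm{sz}^{\mathrm{odd}}_\lambda(z)\,\mathrm{sz}^{\mathrm{odd}}_{\lambda'}(y) &=2\left(\prod_{j=1}^n\prod_{k=1}^m(z_j+y_k)^2\right)\left(\prod_{j=1}^n(2+z_j)\right)\left(\prod_{k=1}^m(2+y_k)\right).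 \end{align*}
   Context: $\lambda'$ is the conjugate partition and $\mathrm{s}_\lambda$ the Schur function; $\mathrm{s}_\lambda^{(N)}$ is the Schur polynomial in $N$ variables (zero if $\ell(\lambda)>N$). $\operatorname{Sym}_N$ is the algebra of symmetric polynomials in $N$ variables over $\mathbb{C}$. For $P\in\operatorname{Sym}_{2N}$, $\Phi_N(P)$ is the unique $Q\in\operatorname{Sym}_N$ with $P(x_1,\ldots,x_N,x_1^{-1},\ldots,x_N^{-1})=Q(x_1+x_1^{-1},\ldots,x_N+x_N^{-1})$; for $P\in\operatorname{Sym}_{2N+1}$, $\Phi_N^{\mathrm{odd}}(P)$ is the unique $Q\in\operatorname{Sym}_N$ with $P(x_1,\ldots,x_N,x_1^{-1},\ldots,x_N^{-1},1)=Q(x_1+x_1^{-1},\ldots,x_N+x_N^{-1})$ (existence and uniqueness hold). Put $\mathrm{sz}^{(N)}_\lambda=\Phi_N(\mathrm{s}^{(2N)}_\lambda)$ and $\mathrm{sz}^{\mathrm{odd},(N)}_\lambda=\Phi^{\mathrm{odd}}_N(\mathrm{s}^{(2N+1)}_\lambda)$; the superscript $(N)$ is omitted when the list of variables is indicated, so $\mathrm{sz}_\lambda(z)=\mathrm{sz}^{(n)}_\lambda(z_1,\ldots,z_n)$ and $\mathrm{sz}_\lambda(y)=\mathrm{sz}^{(m)}_\lambda(y_1,\ldots,y_m)$, and similarly for $\mathrm{sz}^{\mathrm{odd}}$. The first and fourth identities are understood as identities of formal power series in $y_1,\ldots,y_m$ with coefficients polynomial in $z_1,\ldots,z_n$; in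 the other identities only finitely many summands are nonzero. *)

(* Defs.v *)
From HB Require Import structures.
From mathcomp Require Import all_boot all_order all_algebra.
From mathcomp Require Import boolp classical_sets cardinality fsbigop reals.
From mathcomp Require Import complex mpoly.

Set Implicit Arguments.
Unset Strict Implicit.
Unset Printing Implicit Defensive.

Import Order.TTheory GRing.Theory.

Local Open Scope ring_scope.

Definition is_intpart (s : seq nat) : bool := sorted geq s && (0%N \notin s).

Record intpart := IntPart { parts :> seq nat; _ : is_intpart parts }.

HB.instance Definition _ := [isSub for parts].
HB.instance Definition _ := [Countable of intpart by <:].

Definition conj_seq (s : seq nat) : seq nat :=
  mkseq (fun j => count (fun r => (j < r)%N) s) (head 0%N s).

Lemma conj_seqP (la : intpart) : is_intpart (conj_seq la).
Proof.
case: la => s /= _; rewrite /is_intpart; apply/andP; split.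
  apply: (@homo_sorted_in _ _ predT _ ltn); last exact: iota_ltn_sorted.
    move=> i j _ _ /= lt_ij; apply: sub_count => r /=.
    exact/ltn_trans.
  by apply/allP.
apply/negP => /mapP[j]; rewrite mem_iota /= add0n => lt_js.
move=> /esym/eqP; rewrite eqn0Ngt -has_count => /negP; apply.
by case: s lt_js => //= r s ->.
Qed.

Definition conj_part (la : intpart) : intpart := IntPart (conj_seqP la).

Section Schur.
Variables (R : comNzRingType) (N : nat).

Definition hsym (k : nat) : {mpoly R[N]} :=
  \sum_(u : 'X_{1..N < k.+1} | mdeg u == k) 'X_[u].

(* Jacobi-Trudi: the Schur function is det (h_(la_i - i + j)), with h_k = 0
   for k < 0; here it is specialized to N variables. *)
Definition schur (la : intpart) : {mpoly R[N]} :=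
  \det (\matrix_(i < size la, j < size la)
    if (i <= nth 0%N la i + j)%N then hsym (nth 0%N la i + j - i) else 0).

End Schur.

Section ChangeOfVariables.
Variable C : numClosedFieldType.

Definition recip_point N (x : 'I_N -> C) (k : 'I_(N + N)) : C :=
  match split k with inl j => x j | inr j => (x j)^-1 end.

Definition recip1_point N (x : 'I_N -> C) (k : 'I_(N + N + 1)) : C :=
  match split k with inl j => recip_point x j | inr _ => 1 end.

(* Laurent polynomials over C are identified with the functions they induce on
   nonzero points. Q exists and is unique for symmetric P; Phi and Phi_odd take
   the junk value 0 where no Q exists. *)
Definition Phi N (P : {mpoly C[N + N]}) : {mpoly C[N]} :=
  xget 0 [set Q | Q \is symmetric /\
    forall x : 'I_N -> C, (forall j, x j != 0) ->
      P.@[recip_point x] = Q.@[fun j => x j + (x j)^-1]].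

Definition Phi_odd N (P : {mpoly C[N + N + 1]}) : {mpoly C[N]} :=
  xget 0 [set Q | Q \is symmetric /\
    forall x : 'I_N -> C, (forall j, x j != 0) ->
      P.@[recip1_point x] = Q.@[fun j => x j + (x j)^-1]].

Definition sz N (la : intpart) : {mpoly C[N]} := Phi (schur C (N + N) la).

Definition sz_odd N (la : intpart) : {mpoly C[N]} :=
  Phi_odd (schur C (N + N + 1) la).

End ChangeOfVariables.

Record mfps (R : Type) (m : nat) := MFps { mfcoef : 'X_{1..m} -> R }.

HB.instance Definition _ R m := gen_eqMixin (mfps R m).
HB.instance Definition _ R m := gen_choiceMixin (mfps R m).

Lemma mfpsP R m (f g : mfps R m) : mfcoef f =1 mfcoef g -> f = g.
Proof. by case: f => f; case: g => g /= /funext ->. Qed.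

Section MFpsZmod.
Variables (R : zmodType) (m : nat).
Implicit Types f g h : mfps R m.

Definition mfps_zero : mfps R m := MFps (fun=> 0).
Definition mfps_opp f : mfps R m := MFps (fun u => - mfcoef f u).
Definition mfps_add f g : mfps R m := MFps (fun u => mfcoef f u + mfcoef g u).

Lemma mfps_addA : associative mfps_add.
Proof. by move=> f g h; apply: mfpsP => u /=; rewrite addrA. Qed.

Lemma mfps_addC : commutative mfps_add.
Proof. by move=> f g; apply: mfpsP => u /=; rewrite addrC. Qed.

Lemma mfps_add0 : left_id mfps_zero mfps_add.
Proof. by move=> f; apply: mfpsP => u /=; rewrite add0r. Qed.

Lemma mfps_addN : left_inverse mfps_zero mfps_opp mfps_add.
Proof. by move=> f; apply: mfpsP => u /=; rewrite addNr. Qed.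

HB.instance Definition _ := GRing.isZmodule.Build (mfps R m)
  mfps_addA mfps_addC mfps_add0 mfps_addN.

Lemma mfcoefD f g u : mfcoef (f + g) u = mfcoef f u + mfcoef g u.
Proof. by []. Qed.

Lemma mfcoefN f u : mfcoef (- f) u = - mfcoef f u.
Proof. by []. Qed.

Lemma mfcoef0 u : mfcoef (0 : mfps R m) u = 0.
Proof. by []. Qed.

Lemma mfcoef_sum I (r : seq I) P (F : I -> mfps R m) u :
  mfcoef (\sum_(i <- r | P i) F i) u = \sum_(i <- r | P i) mfcoef (F i) u.
Proof. exact: (big_morph (fun f : mfps R m => mfcoef f u)). Qed.

End MFpsZmod.

Section MFpsRing.
Variables (R : comNzRingType) (m : nat).
Implicit Types f g h : mfps R m.

Definition mfps_of_mpoly (p : {mpoly R[m]}) : mfps R m :=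
  MFps (fun u => p@_u).

Definition mfps_mul f g : mfps R m := MFps (fun u =>
  \sum_(k : 'X_{1..m < (mdeg u).+1, (mdeg u).+1} | u == (k.1 + k.2)%MM)
    mfcoef f k.1 * mfcoef g k.2).

Definition mfps_trunc d f : {mpoly R[m]} :=
  \sum_(u : 'X_{1..m < d}) mfcoef f u *: 'X_[u].

Lemma mcoeff_trunc d f u : (mdeg u < d)%N -> (mfps_trunc d f)@_u = mfcoef f u.
Proof. by move=> ltud; rewrite mcoeff_mpoly. Qed.

Lemma mfps_mul_approx d f g (p q : {mpoly R[m]}) u : (mdeg u < d)%N ->
    (forall v, (mdeg v < d)%N -> mfcoef f v = p@_v) ->
    (forall v, (mdeg v < d)%N -> mfcoef g v = q@_v) ->
  mfcoef (mfps_mul f g) u = (p * q)@_u.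
Proof.
move=> ltud fp gq; rewrite mcoeffM; apply: eq_bigr => -[v w] _ /=.
by rewrite fp ?gq // (leq_trans (bmdeg _) ltud).
Qed.

Lemma mfps_mulE d f g u : (mdeg u < d)%N ->
  mfcoef (mfps_mul f g) u = (mfps_trunc d f * mfps_trunc d g)@_u.
Proof.
by move=> ltud; apply: (mfps_mul_approx ltud) => v ltvd; rewrite mcoeff_trunc.
Qed.

Lemma mfps_mulA : associative mfps_mul.
Proof.
move=> f g h; apply: mfpsP => u; pose d := (mdeg u).+1.
transitivity (mfps_trunc d f * (mfps_trunc d g * mfps_trunc d h))@_u.
  apply: (@mfps_mul_approx d) => // v ltvd; first by rewrite mcoeff_trunc.
  exact: mfps_mulE.
rewrite mulrA; symmetry; apply: (@mfps_mul_approx d) => // v ltvd.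
  exact: mfps_mulE.
by rewrite mcoeff_trunc.
Qed.

Lemma mfps_mulC : commutative mfps_mul.
Proof.
move=> f g; apply: mfpsP => u.
by rewrite !(@mfps_mulE (mdeg u).+1) // mulrC.
Qed.

Lemma mfps_mul1 : left_id (mfps_of_mpoly 1) mfps_mul.
Proof.
move=> f; apply: mfpsP => u; pose d := (mdeg u).+1.
rewrite (@mfps_mul_approx d _ _ 1 (mfps_trunc d f)) //.
  by rewrite mul1r mcoeff_trunc.
by move=> v ltvd; rewrite mcoeff_trunc.
Qed.

Lemma mfps_mulD : left_distributive mfps_mul +%R.
Proof.
move=> f g h; apply: mfpsP => u /=; rewrite -big_split /=.
by apply: eq_bigr => k _; rewrite mulrDl.
Qed.

Lemma mfps_one_neq0 : mfps_of_mpoly 1 != 0.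
Proof.
apply/eqP => /(congr1 (fun f : mfps R m => mfcoef f 0%MM)) /=.
by rewrite mcoeff1 eqxx => /eqP; rewrite oner_eq0.
Qed.

HB.instance Definition _ := GRing.Zmodule_isComNzRing.Build (mfps R m)
  mfps_mulA mfps_mulC mfps_mul1 mfps_mulD mfps_one_neq0.

Lemma mfcoef_approx d f g (p q : {mpoly R[m]}) u : (mdeg u < d)%N ->
    (forall v, (mdeg v < d)%N -> mfcoef f v = p@_v) ->
    (forall v, (mdeg v < d)%N -> mfcoef g v = q@_v) ->
  mfcoef (f * g) u = (p * q)@_u.
Proof. exact: mfps_mul_approx. Qed.

Lemma mfcoefM f g u : mfcoef (f * g) u =
  \sum_(k : 'X_{1..m < (mdeg u).+1, (mdeg u).+1} | u == (k.1 + k.2)%MM)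
    mfcoef f k.1 * mfcoef g k.2.
Proof. by []. Qed.

Lemma mfcoef1 u : mfcoef (1 : mfps R m) u = (u == 0%MM)%:R.
Proof. exact: mcoeff1. Qed.

Lemma mfcoefM0 f g : mfcoef (f * g) 0%MM = mfcoef f 0%MM * mfcoef g 0%MM.
Proof.
have approx h v : (mdeg v < 1)%N -> mfcoef h v = (mfps_trunc 1 h)@_v.
  by move=> ltv1; rewrite mcoeff_trunc.
rewrite (mfcoef_approx _ (approx f) (approx g)) ?mdeg0 // rmorphM /=.
by rewrite -!approx ?mdeg0.
Qed.

Lemma mfps_of_mpoly_is_additive : additive mfps_of_mpoly.
Proof. by move=> p q; apply: mfpsP => u /=; rewrite mcoeffB. Qed.

Lemma mfps_of_mpoly_is_multiplicative : multiplicative mfps_of_mpoly.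
Proof.
split=> // p q; apply: mfpsP => u.
by rewrite (@mfcoef_approx (mdeg u).+1 _ _ p q).
Qed.

HB.instance Definition _ := GRing.isAdditive.Build _ _ mfps_of_mpoly
  mfps_of_mpoly_is_additive.
HB.instance Definition _ := GRing.isMultiplicative.Build _ _ mfps_of_mpoly
  mfps_of_mpoly_is_multiplicative.

Lemma mfcoef_expr_low f k u :
  mfcoef f 0%MM = 0 -> (mdeg u < k)%N -> mfcoef (f ^+ k) u = 0.
Proof.
move=> f0; elim: k u => // k IHk u leuk; rewrite exprS mfcoefM big1 //.
case=> v w /= /eqP def_u; have [v0|v_neq0] := eqVneq (v : 'X_{1..m}) 0%MM.
  by rewrite v0 f0 mul0r.
rewrite IHk ?mulr0 //; have := congr1 (@mdeg m) def_u; rewrite mdegD => degu.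
have {degu}: (mdeg v + mdeg w <= k)%N by rewrite -degu.
apply: leq_trans.
by rewrite -add1n leq_add2r lt0n mdeg_eq0.
Qed.

End MFpsRing.

Section MFpsUnitRing.
Variables (R : comUnitRingType) (m : nat).
Implicit Types f g h : mfps R m.

Definition mfps_unit f := mfcoef f 0%MM \is a GRing.unit.

Definition mfps_cst (c : R) : mfps R m := mfps_of_mpoly c%:MP.

(* Geometric series of 1 - f / f(0), truncated where it no longer contributes. *)
Definition mfps_inv f : mfps R m :=
  if mfps_unit f then
    let c := mfps_cst (mfcoef f 0%MM)^-1 in
    c * MFps (fun u => mfcoef (\sum_(k < (mdeg u).+1) (1 - c * f) ^+ k) u)
  else f.

Lemma mfps_mulVx : {in mfps_unit, left_inverse 1 mfps_inv *%R}.
Proof.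
move=> f uf; have uf0 : mfcoef f 0%MM \is a GRing.unit by [].
rewrite /mfps_inv; have -> : mfps_unit f = true by [].
set c := mfps_cst _; set G := MFps _; set a := 1 - c * f.
have a0 : mfcoef a 0%MM = 0.
  rewrite mfcoefD mfcoefN mfcoefM0 mfcoef1 eqxx /c /= mcoeffC eqxx mulr1.
  by rewrite mulVr ?subrr.
rewrite -mulrA (mulrCA c) (_ : c * f = 1 - a); last by rewrite opprB addrC subrK.
apply: mfpsP => u; pose d := (mdeg u).+1.
transitivity (mfcoef ((\sum_(k < d) a ^+ k) * (1 - a)) u).
  rewrite !mfcoefM; apply: eq_bigr => -[v w] /= _; congr (_ * _).
  have levd : ((mdeg v).+1 <= d)%N := bmdeg v.
  rewrite !mfcoef_sum (big_ord_widen d (fun k => mfcoef (a ^+ k) v) levd).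
  rewrite big_mkcond /=; apply: eq_bigr => k _; case: ifPn => //.
  by rewrite -leqNgt => ltvk; rewrite mfcoef_expr_low.
rewrite mulrC -[1 - a]opprB mulNr -subrX1 opprB mfcoefD mfcoefN.
by rewrite mfcoef_expr_low ?subr0.
Qed.

Lemma mfps_unitPl f g : g * f = 1 -> mfps_unit f.
Proof.
move=> /(congr1 (fun f : mfps R m => mfcoef f 0%MM)); rewrite mfcoefM0 mfcoef1 eqxx => gf1.
by apply/unitrPr; exists (mfcoef g 0%MM); rewrite mulrC.
Qed.

Lemma mfps_inv_out : {in [predC mfps_unit], mfps_inv =1 id}.
Proof. by move=> f /negbTE nuf; rewrite /mfps_inv (_ : mfps_unit f = false). Qed.

HB.instance Definition _ := GRing.ComNzRing_hasMulInverse.Build (mfps R m)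
  mfps_mulVx mfps_unitPl mfps_inv_out.

End MFpsUnitRing.

Section Sums.
Local Open Scope classical_set_scope.

(* The sum over [set: I] is 0 by convention when F has infinite support. *)
Definition sums_to (I : choiceType) (V : nmodType) (F : I -> V) (S : V) :=
  finite_set [set i | F i != 0] /\ \sum_(i \in [set: I]) F i = S.

(* Convergence in the product topology, with discrete coefficients. *)
Definition mfps_sums_to (I : choiceType) (R : zmodType) m
    (F : I -> mfps R m) (S : mfps R m) :=
  forall u, sums_to (fun i => mfcoef (F i) u) (mfcoef S u).

End Sums.

Section Variables_zy.
Variables (C : numClosedFieldType) (n m : nat).

(* Polynomials in z and y are taken in C[z][y]. *)
Definition in_z (p : {mpoly C[n]}) : {mpoly {mpoly C[n]}[m]} := p%:MP.

Definition in_y (q : {mpoly C[m]}) : {mpoly {mpoly C[n]}[m]} :=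
  map_mpoly (@mpolyC n C) q.

Definition zvar (j : 'I_n) : {mpoly {mpoly C[n]}[m]} := in_z 'X_j.

Definition yvar (k : 'I_m) : {mpoly {mpoly C[n]}[m]} := in_y 'X_k.

End Variables_zy.

Arguments in_z {C n} m p.
Arguments in_y {C} n {m} q.
Arguments zvar {C n} m j.
Arguments yvar {C} n {m} k.

(* Main.v *)
Require Import Defs.
From HB Require Import structures.
From mathcomp Require Import all_boot all_order all_fingroup all_algebra.
From mathcomp Require Import boolp classical_sets cardinality fsbigop reals.
From mathcomp Require Import complex mpoly.
From mathcomp Require Import zify ring.

Set Implicit Arguments.
Unset Strict Implicit.
Unset Printing Implicit Defensive.

Import Order.TTheory GRing.Theory.

Local Open Scope ring_scope.

(** Everything is reduced to Schur functions written as Jacobi-Trudi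
    determinants [det (g (la_i - i + j))] of one sequence [g], and the sequence
    is read off a polynomial [P] with [P(0) = 1]: [g] is the sequence of Taylor
    coefficients of [1 / P].  For [P = \prod_k (1 - y_k t)] the sequence is that
    of the complete symmetric polynomials and the determinant is the Schur
    polynomial.

    The map [Phi] is a morphism, so it may be applied entry by entry: the roots
    [x_j] and [1 / x_j] contribute [(1 - x_j t) (1 - t / x_j) = 1 - z_j t + t^2]
    with [z_j = x_j + 1 / x_j], whence [sz_la] is the Jacobi-Trudi determinant
    of [\prod_j (1 - z_j t + t^2)^-1], with an additional factor [1 / (1 - t)] in
    the odd case ([sz_jacobi_trudi], [sz_odd_jacobi_trudi]).  Every complex
    number is some [x + 1 / x] with [x] nonzero, which makes the polynomial
    [Phi S] unique and turns its defining property into a formula.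

    All sums come from one identity, [finite_Cauchy]: for a polynomial [P] and
    variables [y_1 .. y_m], the sum of [det (P_(la_i - i + j)) s_la(y)] over
    partitions [la] is [\prod_k P(y_k)].  The product of the Toeplitz matrix
    [(P_(p - q))] by the matrix [(y_k ^ p)] is the Vandermonde matrix with the
    column of [y_k] multiplied by [P(y_k)]; Cauchy-Binet expands its determinant
    over strictly decreasing exponents, that is over partitions, and each
    alternant [det (y_k ^ (la_a + m - a))] is the Vandermonde determinant times
    [s_la(y)] ([bialternant]).

    - The dual sums use the dual Jacobi-Trudi formula [dual_jacobi_trudi]: the
      determinant of [1 / P] at [la] is the determinant of the polynomial
      [P(- t)] at the conjugate partition.  Hence [finite_Cauchy] applies and
      gives [\prod_k P(- y_k)]; only partitions in a box contribute.
    - When [y] is itself specialized, it suffices to compare both sides at the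
      points [y_k = x_k + 1 / x_k], which is [finite_Cauchy] at the [2m] or
      [2m + 1] values [x_k], [1 / x_k] and possibly 1.
    - For the two infinite sums, the coefficient of a monomial of degree [D]
      involves only partitions of [D], and these only see the first [D + 1]
      coefficients of [1 / P]; so [finite_Cauchy] applies to the truncation of
      [1 / P] at degree [D]. *)

(** * The Cauchy-Binet formula *)

Section CauchyBinet.
Variable A : comNzRingType.

Definition decreasing m K (f : {ffun 'I_m -> 'I_K}) :=
  [forall i : 'I_m, forall j : 'I_m, (i < j)%N ==> (f j < f i)%N].

Lemma decreasingP m K (f : {ffun 'I_m -> 'I_K}) :
  reflect (forall i j : 'I_m, (i < j)%N -> (f j < f i)%N) (decreasing f).
Proof.
apply: (iffP forallP) => [df i j ltij|df i].
  by move/forallP/(_ j)/implyP: (df i); apply.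
by apply/forallP => j; apply/implyP/df.
Qed.

Lemma decreasing_ltn m K (f : {ffun 'I_m -> 'I_K}) (i j : 'I_m) :
  decreasing f -> (f i < f j)%N = (j < i)%N.
Proof.
move/decreasingP=> df; apply/idP/idP; last exact: df.
case: (ltngtP j i) => // [/df|/val_inj->]; last by rewrite ltnn.
by case: ltngtP.
Qed.

Lemma increasing_geq_id m (t : 'I_m -> 'I_m) :
  (forall i j : 'I_m, (i < j)%N -> (t i < t j)%N) -> forall i : 'I_m, (i <= t i)%N.
Proof.
move=> it [i lti] /=; elim: i lti => // i IHi lti.
exact: leq_ltn_trans (IHi (ltnW lti)) (it (Ordinal (ltnW lti)) (Ordinal lti) (ltnSn i)).
Qed.

(** Both the permutation and its inverse move every index up. *)
Lemma increasing_perm1 m (t : 'S_m) :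
  (forall i j : 'I_m, (i < j)%N -> (t i < t j)%N) -> t = 1%g.
Proof.
move=> it; have itV (i j : 'I_m) : (i < j)%N -> ((t^-1)%g i < (t^-1)%g j)%N.
  move=> ltij; rewrite ltnNge leq_eqVlt; apply/norP; split.
    by apply/negP => /eqP/val_inj/perm_inj eqji; rewrite eqji ltnn in ltij.
  by apply/negP => /it; rewrite !permKV ltnNge (ltnW ltij).
apply/permP => i; rewrite perm1; apply/val_inj/eqP; rewrite eqn_leq /=.
have := increasing_geq_id itV (t i); rewrite permK => ->.
exact: increasing_geq_id it i.
Qed.

Lemma injective_sortable m K (f : {ffun 'I_m -> 'I_K}) : injective f ->
  exists s : 'S_m, decreasing [ffun i => f (s i)].
Proof.
case: m f => [|m] f injf.
  by exists 1%g; apply/decreasingP => -[].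
pose r := sort (fun i j : 'I_m.+1 => (f j <= f i)%N) (enum 'I_m.+1).
have szr : size r = m.+1 by rewrite size_sort size_enum_ord.
have ur : uniq r by rewrite sort_uniq enum_uniq.
have inj_nth : injective (fun i : 'I_m.+1 => nth ord0 r i).
  move=> i j /eqP; rewrite nth_uniq ?szr // => /eqP; exact: val_inj.
exists (perm inj_nth); apply/decreasingP => i j ltij; rewrite !ffunE !permE.
have tr : transitive (fun i j : 'I_m.+1 => (f j <= f i)%N).
  by move=> a b c ab bc; apply: leq_trans bc ab.
have tot : total (fun i j : 'I_m.+1 => (f j <= f i)%N) by move=> a b; apply: leq_total.
have := sorted_ltn_nth tr ord0 (sort_sorted tot (enum 'I_m.+1)).
move=> /(_ i j); rewrite -/r !inE szr => /(_ (ltn_ord i) (ltn_ord j) ltij).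
rewrite leq_eqVlt => /orP[/eqP/val_inj/injf/inj_nth eqji|//].
by rewrite eqji ltnn in ltij.
Qed.

(** Together with [injective_sortable], this factors an injective map uniquely
    as a permutation followed by a strictly decreasing map. *)
Lemma decreasing_perm_uniq m K (f g : {ffun 'I_m -> 'I_K}) (s t : 'S_m) :
    decreasing f -> decreasing g ->
    [ffun i => f (s i)] = [ffun i => g (t i)] -> f = g /\ s = t.
Proof.
move=> df dg /ffunP eqfg.
have fE i : f i = g ((s^-1 * t)%g i).
  by have := eqfg ((s^-1)%g i); rewrite !ffunE permM permKV.
suff st1 : (s^-1 * t)%g = 1%g.
  split; first by apply/ffunP => i; rewrite fE st1 perm1.
  by rewrite -[t](mulKVg s) st1 mulg1.
apply: increasing_perm1 => i j ltij.
by rewrite -(decreasing_ltn _ _ dg) -!fE decreasing_ltn.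
Qed.

(** Multilinearity in the rows of [N]; the map [f] chooses one term in each of
    the sums defining the entries of the product. *)
Lemma det_mulmx_rect m K (M : 'M[A]_(m, K)) (N : 'M[A]_(K, m)) :
  \det (M *m N) =
  \sum_(f : {ffun 'I_m -> 'I_K}) (\prod_i M i (f i)) * \det (rowsub f N).
Proof.
transitivity (\sum_(s : 'S_m) \sum_(f : {ffun 'I_m -> 'I_K})
    (-1) ^+ s * \prod_i (M i (f i) * N (f i) (s i))).
  apply: eq_bigr => s _; rewrite -big_distrr /=.
  rewrite -(bigA_distr_bigA (fun i k => M i k * N k (s i))) /=.
  by congr (_ * _); apply: eq_bigr => i _; rewrite mxE.
rewrite exchange_big; apply: eq_bigr => f _; rewrite big_distrr /=.
apply: eq_bigr => s _; rewrite big_split /= mulrCA; congr (_ * (_ * _)).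
by apply: eq_bigr => i _; rewrite mxE.
Qed.

(** In [det_mulmx_rect] a non-injective choice repeats a row of [N] and
    contributes 0; the injective choices are grouped by their decreasing
    rearrangement, and the permutations in one group add up to a minor of
    [M]. *)
Theorem Cauchy_Binet m K (M : 'M[A]_(m, K)) (N : 'M[A]_(K, m)) :
  \det (M *m N) =
  \sum_(f : {ffun 'I_m -> 'I_K} | decreasing f)
    \det (colsub f M) * \det (rowsub f N).
Proof.
pose h (p : {ffun 'I_m -> 'I_K} * 'S_m) := [ffun i => p.1 (p.2 i)].
pose D := [set p : {ffun 'I_m -> 'I_K} * 'S_m | decreasing p.1].
have hinj : {in D &, injective h}.
  move=> [f s] [g t]; rewrite !inE /= => df dg eqh.
  by have [/= -> /= ->] := decreasing_perm_uniq df dg eqh.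
rewrite det_mulmx_rect (bigID (mem (h @: D))) /= [X in _ + X]big1 ?addr0; last first.
  move=> f nhf; have [/injectiveP injf|/injectivePn[i [j neqij eqf]]] :=
    boolP (injectiveb f).
    have [s ds] := injective_sortable injf; case/negP: nhf.
    apply/imsetP; exists ([ffun i => f (s i)], (s^-1)%g); first by rewrite inE.
    by apply/ffunP => i; rewrite !ffunE /= permKV.
  rewrite (determinant_alternate neqij) ?mulr0 // => k.
  by rewrite !mxE eqf.
rewrite (big_imset _ hinj) /=.
transitivity (\sum_(f : {ffun 'I_m -> 'I_K} | decreasing f) \sum_(s : 'S_m)
    (\prod_i M i (h (f, s) i)) * \det (rowsub (h (f, s)) N)).
  rewrite pair_big_dep; apply: eq_big => [[f s]|[f s] _] //=.
  by rewrite inE andbT.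
apply: eq_bigr => f _; rewrite big_distrl /=; apply: eq_bigr => s _.
have -> : rowsub (h (f, s)) N = row_perm s (rowsub f N).
  by apply/matrixP => i j; rewrite !mxE ffunE.
rewrite row_permE det_mulmx det_perm mulrCA mulrA; congr (_ * _ * _).
by apply: eq_bigr => i _; rewrite mxE ffunE.
Qed.

End CauchyBinet.

(** * Power series inverse to a polynomial *)

Section InverseSeries.
Variable A : comNzRingType.
Implicit Types (P : {poly A}) (g h : nat -> A).

(** A power series is given by its sequence of coefficients: the convolution
    says that the product of [P] and [h] is 1. *)
Definition inverse_series P h :=
  forall p, \sum_(r < p.+1) P`_r * h (p - r)%N = (p == 0%N)%:R.

(** The Toeplitz entry [g_(a - b)], where a negative index yields 0; the
    truncated subtraction of natural numbers requires the test. *)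
Definition shifted g (a b : nat) : A := if (b <= a)%N then g (a - b)%N else 0.

Lemma shiftedD g c a b : shifted g (a + c) (b + c) = shifted g a b.
Proof. by rewrite /shifted leq_add2r subnDr. Qed.

Lemma coef_mul_trunc P h N p : (p < N)%N ->
  (P * \poly_(i < N) h i)`_p = \sum_(r < p.+1) P`_r * h (p - r)%N.
Proof.
move=> ltpN; rewrite coefM; apply: eq_bigr => r _.
by rewrite coef_poly (leq_ltn_trans (leq_subr _ _) ltpN).
Qed.

(** Extending a convolution to any range that exceeds the degree of [P] is
    harmless, because [shifted] vanishes beyond the index [p]. *)
Lemma sum_shifted P h l p : (size P <= l)%N ->
  \sum_(r < l) P`_r * shifted h p r = \sum_(r < p.+1) P`_r * h (p - r)%N.
Proof.
move=> szP; pose F r := P`_r * shifted h p r.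
have trunc k : (forall r, (k <= r)%N -> F r = 0) ->
    \sum_(r < k) F r = \sum_(r < k + (l + p)) F r.
  move=> F0; rewrite big_split_ord /= [X in _ = _ + X]big1 ?addr0 // => i _.
  by rewrite F0 // leq_addr.
transitivity (\sum_(r < p.+1) F r); last first.
  by apply: eq_bigr => r _; rewrite /F /shifted -ltnS ltn_ord.
have -> : \sum_(r < l) P`_r * shifted h p r = \sum_(r < l + p.+1) F r.
  rewrite big_split_ord /= [X in _ = _ + X]big1 ?addr0 // => i _.
  by rewrite /F nth_default ?mul0r // (leq_trans szP) ?leq_addr.
rewrite addnC big_split_ord /= [X in _ + X]big1 ?addr0 // => i _.
by rewrite /F /shifted leqNgt ltnS leq_addr mulr0.
Qed.

Lemma inverse_series_uniq P h h' : P`_0 = 1 ->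
  inverse_series P h -> inverse_series P h' -> h =1 h'.
Proof.
move=> P0 hP hP' p; elim/ltn_ind: p => p IHp.
have := etrans (hP p) (esym (hP' p)).
rewrite !big_ord_recl /= subn0 P0 !mul1r => /eqP.
rewrite (eq_bigr (fun i : 'I_p => P`_(bump 0 i) * h' (p - bump 0 i)%N)) => [|i _].
  by move/eqP/addIr.
rewrite IHp // /bump /=; have := ltn_ord i; lia.
Qed.

(** The coefficient of degree [p] in the geometric series of [1 - P], truncated
    where the powers no longer contribute (if [P] has constant term 1). *)
Definition inv_coef P p : A := (\sum_(k < p.+1) (1 - P) ^+ k)`_p.

Lemma coef_expr_low (Q : {poly A}) k p : Q`_0 = 0 -> (p < k)%N -> (Q ^+ k)`_p = 0.
Proof.
move=> Q0; elim: k p => // k IHk p ltpk; rewrite exprS coefM big1 // => -[i lti] _ /=.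
case: i lti => [|i] lti; first by rewrite Q0 mul0r.
by rewrite IHk ?mulr0 //; lia.
Qed.

Lemma inv_coefP P : P`_0 = 1 -> inverse_series P (inv_coef P).
Proof.
move=> P0 p; have Q0 : (1 - P)`_0 = 0 by rewrite coefB coef1 P0 subrr.
transitivity ((P * \sum_(k < p.+1) (1 - P) ^+ k)`_p).
  rewrite coefM; apply: eq_bigr => -[r ltr] _ /=; congr (_ * _).
  rewrite /inv_coef !coef_sum.
  have le_p : ((p - r).+1 <= p.+1)%N by rewrite ltnS leq_subr.
  rewrite (big_ord_widen _ (fun k => ((1 - P) ^+ k)`_(p - r)) le_p) big_mkcond /=.
  apply: eq_bigr => k _; case: ifPn => //; rewrite -leqNgt => ltk.
  by rewrite coef_expr_low.
rewrite -{1}[P](subKr 1) -opprB mulNr -subrX1 opprB coefB coef1.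
by rewrite coef_expr_low // subr0.
Qed.

End InverseSeries.

Lemma inverse_series_map (A A' : comNzRingType) (phi : {rmorphism A -> A'})
    (P : {poly A}) (h : nat -> A) :
  inverse_series P h -> inverse_series (map_poly phi P) (phi \o h).
Proof.
move=> hP p; rewrite -(rmorph_nat phi) -hP rmorph_sum.
by apply: eq_bigr => r _; rewrite rmorphM coef_map.
Qed.

(** * Jacobi-Trudi determinants *)

Section JacobiTrudi.
Variable A : comNzRingType.
Implicit Types (P : {poly A}) (g h : nat -> A) (la : seq nat).

(** The size [n] is separate from [la] so that determinants of partitions with
    different numbers of parts can be compared at a common size. *)
Definition jacobi_trudi g n la : A :=
  \det (\matrix_(i < n, j < n) shifted g (nth 0%N la i + j) i).

(** A zero part adds a last row [0 .. 0 g_0]. *)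
Lemma jacobi_trudi_pad g la n : g 0%N = 1 -> (size la <= n)%N ->
  jacobi_trudi g n la = jacobi_trudi g (size la) la.
Proof.
move=> g0 /subnKC <-; elim: (n - size la)%N => [|k IHk]; first by rewrite addn0.
rewrite addnS -IHk /jacobi_trudi (expand_det_row _ ord_max).
have la0 : nth 0%N la (size la + k) = 0%N by rewrite nth_default ?leq_addr.
rewrite (bigD1 ord_max) //= big1 ?addr0 => [|j neqj]; last first.
  rewrite mxE /= la0 add0n /shifted leqNgt; case: ltnP => /= [_|gej]; first by rewrite mul0r.
  case/eqP: neqj; apply: val_inj => /=; have := ltn_ord j; lia.
rewrite mxE /= la0 add0n /shifted leqnn subnn g0 mul1r /cofactor /=.
rewrite addnn -signr_odd odd_double expr0 mul1r.
congr (\det _); apply/matrixP => i j; rewrite !mxE /= /bump.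
by rewrite ![(size la + k <= _)%N]leqNgt !ltn_ord.
Qed.

(** The recurrence satisfied by [h] is a linear relation, with coefficients
    those of [P], between the columns.  It holds in each row because a positive
    part makes the relation one of positive degree. *)
Lemma jacobi_trudi_size0 P h la : P`_0 = 1 -> inverse_series P h ->
    0%N \notin la -> (size P <= size la)%N ->
  jacobi_trudi h (size la) la = 0.
Proof.
move=> P0 hP la0 szP; rewrite /jacobi_trudi; set M := matrix_of_fun _ _.
have la_gt0 : (0 < size la)%N.
  apply: leq_trans szP; rewrite lt0n size_poly_eq0; apply: contraTneq isT => P_0.
  by move/eqP: P0; rewrite P_0 coef0 eq_sym oner_eq0.
pose l := (size la).-1; have lE : size la = l.+1 by rewrite prednK.
pose v : 'cV[A]_(size la) := \col_j P`_(l - j).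
have Mv0 : M *m v = 0.
  apply/matrixP => i k; rewrite !mxE.
  rewrite (reindex_inj rev_ord_inj) /=.
  transitivity (\sum_(r < size la) P`_r * shifted h (nth 0%N la i + l - i) r).
    apply: eq_bigr => r _; rewrite !mxE /= mulrC.
    have ltr := ltn_ord r; have lti := ltn_ord i.
    congr (P`__ * _); first by lia.
    rewrite -(shiftedD _ r) -[RHS](shiftedD _ i); congr shifted; lia.
  rewrite sum_shifted // hP (_ : (_ == _) = false) //; apply/eqP.
  have lti := ltn_ord i; have := mem_nth 0%N lti.
  case: (nth _ _ _) => [la_0|x _]; [by rewrite la_0 in la0 | lia].
(* the last entry of v is 1, so it survives multiplication by det M *)
have := congr1 (mulmx (\adj M)) Mv0.
rewrite mulmxA mul_adj_mx mulmx0 mul_scalar_mx => /matrixP.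
have ltl : (l < size la)%N by lia.
by move/(_ (Ordinal ltl) ord0); rewrite !mxE /= subnn P0 mulr1.
Qed.

(** The first row only contains coefficients of [P] beyond its degree. *)
Lemma jacobi_trudi_head0 P la : (0 < size la)%N -> (size P <= head 0%N la)%N ->
  jacobi_trudi (fun r => P`_r) (size la) la = 0.
Proof.
move=> la_gt0 szP; rewrite /jacobi_trudi (expand_det_row _ (Ordinal la_gt0)) big1 // => j _.
rewrite mxE /shifted /= subn0 nth0 nth_default ?mul0r //.
exact: leq_trans szP (leq_addr _ _).
Qed.

End JacobiTrudi.

Lemma jacobi_trudi_map (A A' : comNzRingType) (phi : {rmorphism A -> A'})
    (g : nat -> A) n la :
  phi (jacobi_trudi g n la) = jacobi_trudi (phi \o g) n la.
Proof.
rewrite -det_map_mx; congr (\det _); apply/matrixP => i j; rewrite !mxE /shifted.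
by case: ifP => //= _; rewrite rmorph0.
Qed.

Lemma eq_jacobi_trudi (A : comNzRingType) (g g' : nat -> A) n la :
  g =1 g' -> jacobi_trudi g n la = jacobi_trudi g' n la.
Proof. by move=> /funext ->. Qed.

(** * Complete symmetric polynomials *)

Section LinearFactors.
Variables (A : comNzRingType) (m : nat) (y : 'I_m -> A).

Lemma coef0_linear_factors : (\prod_(k < m) (1 - y k *: 'X))`_0 = 1.
Proof.
by rewrite coef0_prod big1 // => k _; rewrite coefB coefZ coefX mulr0 subr0 coef1.
Qed.

Lemma size_linear_factors (Q : pred 'I_m) :
  (size (\prod_(k < m | Q k) (1 - y k *: 'X))%R <= #|Q|.+1)%N.
Proof.
apply: leq_trans (size_poly_prod_leq _ _) _.
have sz2 k : (size (1 - y k *: 'X)%R <= 2)%N.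
  apply: leq_trans (size_polyD _ _) _; rewrite size_poly1 size_polyN geq_max /=.
  by apply: leq_trans (size_scale_leq _ _) _; rewrite size_polyX.
have : (\sum_(k < m | Q k) size (1 - y k *: 'X)%R <= \sum_(k < m | Q k) 2)%N.
  by apply: leq_sum => k _.
rewrite sum_nat_const leq_subLR muln2 -addnn addnS ltnS; exact: id.
Qed.

End LinearFactors.

Section CompleteSymmetric.
Variables (R : comNzRingType) (m : nat).

Lemma mcoeff_hsym d v : (hsym R m d)@_v = (mdeg v == d)%:R.
Proof.
rewrite /hsym raddf_sum /=; have [eq_d|neq_d] := eqVneq (mdeg v) d.
  have ltv : (mdeg v < d.+1)%N by rewrite eq_d.
  rewrite (bigD1 (BMultinom ltv)) /= ?eq_d // mcoeffX eqxx big1 ?addr0 // => u.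
  rewrite mcoeffX -val_eqE /= => /andP[_ /negbTE ->]; by [].
rewrite big1 // => u /eqP eq_d; rewrite mcoeffX; case: eqP => // eq_uv.
by rewrite -eq_uv eq_d eqxx in neq_d.
Qed.

(** Expanding the product of geometric series in the variables, the exponents
    chosen in the factors form a monomial of degree [d]; truncating each series
    at [N > d] loses nothing. *)
Lemma coef_prod_geometric N d : (d < N)%N ->
  (\prod_(k < m) \sum_(i < N) ('X_k *: 'X : {poly {mpoly R[m]}}) ^+ i)`_d
  = hsym R m d.
Proof.
move=> ltdN; rewrite (bigA_distr_bigA (fun k (i : 'I_N) => ('X_k *: 'X) ^+ i)) /=.
apply/mpolyP => v; rewrite mcoeff_hsym coef_sum raddf_sum /=.
have termE (f : {ffun 'I_m -> 'I_N}) :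
    (\prod_k ('X_k *: 'X : {poly {mpoly R[m]}}) ^+ f k)`_d
    = (d == \sum_k f k)%N%:R *: 'X_[[multinom (f k : nat) | k < m]].
  under eq_bigr do rewrite exprZn.
  have -> : 'X_[[multinom (f k : nat) | k < m]] = \prod_k ('X_k : {mpoly R[m]}) ^+ f k.
    by rewrite mpolyXE_id; apply: eq_bigr => k _; rewrite mnmE.
  rewrite scaler_prod prodrXr coefZ coefXn mulrC.
  by rewrite -[(_ == _)%:R in LHS]mpolyC_nat mul_mpolyC.
under eq_bigr do rewrite termE mcoeffZ mcoeffX.
have [eq_d|neq_d] := eqVneq (mdeg v) d; last first.
  rewrite big1 // => f _; case: eqP => [dE|_]; last by rewrite mul0r.
  case: eqP => [vE|_]; last by rewrite mulr0.
  case/eqP: neq_d; rewrite -vE mdegE dE; apply: eq_bigr => k _; by rewrite mnmE.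
have v_lt k : (v k < N)%N.
  apply: leq_ltn_trans ltdN; rewrite -eq_d mdegE (bigD1 k) //=; exact: leq_addr.
rewrite (bigD1 [ffun k => Ordinal (v_lt k)]) //= [X in _ + X]big1 ?addr0 => [|f neqf].
  have -> : (\sum_k [ffun k => Ordinal (v_lt k)] k)%N = d.
    by rewrite -eq_d mdegE; apply: eq_bigr => k _; rewrite ffunE.
  rewrite eqxx mul1r; case: eqP => // -[]; apply/mnmP => k.
  by rewrite mnmE ffunE.
have [vE|_] := eqVneq [multinom (f k : nat) | k < m] v; last by rewrite mulr0.
case/eqP: neqf; apply/ffunP => k; rewrite ffunE; apply: val_inj => /=.
by rewrite -vE mnmE.
Qed.

(** Multiplying each truncated geometric series by [1 - X_k t] leaves
    [1 - (X_k t)^(p + 1)], which is 1 up to degree [p]. *)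
Lemma hsym_inverse :
  inverse_series (\prod_(k < m) (1 - 'X_k *: 'X)) (hsym R m).
Proof.
move=> p; set P := \prod_(_ < _) _.
pose G := \prod_(k < m) \sum_(i < p.+1) ('X_k *: 'X : {poly {mpoly R[m]}}) ^+ i.
transitivity ((P * G)`_p).
  rewrite coefM; apply: eq_bigr => r _.
  by rewrite coef_prod_geometric // ltnS leq_subr.
have -> : P * G = \prod_(k < m) (1 - 'X^(p.+1) * ('X_k ^+ p.+1)%:P).
  rewrite -big_split; apply: eq_bigr => k _ /=.
  by rewrite -[1 - _]opprB mulNr -subrX1 opprB exprZn mulrC mul_polyC.
suff [q ->] : exists q,
    \prod_(k < m) (1 - 'X^(p.+1) * (('X_k : {mpoly R[m]}) ^+ p.+1)%:P) = 1 + 'X^(p.+1) * q.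
  by rewrite coefD coefXnM leqnn addr0 coef1.
apply: (big_ind (fun P' => exists q, P' = 1 + 'X^(p.+1) * q)) => [|_ _ [a ->] [b ->]|k _].
- by exists 0; rewrite mulr0 addr0.
- by exists (a + b + 'X^(p.+1) * a * b); ring.
- by exists (- ('X_k ^+ p.+1)%:P); rewrite mulrN.
Qed.

End CompleteSymmetric.

(** * Alternants *)

Section Bialternant.
Variables (A : comNzRingType) (m : nat) (y : 'I_m -> A) (h : nat -> A).
Hypothesis hP : inverse_series (\prod_(k < m) (1 - y k *: 'X)) h.

(** The exponents are [la_a + (m - 1 - a)]; the empty list gives the Vandermonde
    determinant with its rows in decreasing order of exponent. *)
Definition alternant la : A :=
  \det (\matrix_(a < m, j < m) y j ^+ (nth 0%N la a + (m.-1 - a))).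

Let others j : {poly A} := \prod_(k < m | k != j) (1 - y k *: 'X).

Let size_others j : (size (others j) <= m)%N.
Proof.
apply: leq_trans (size_linear_factors _ _) _.
by have := cardC1 j; rewrite card_ord => ->; rewrite prednK //; case: j => j; case: m.
Qed.

(** The series [1 / (1 - y_j t)] is the product of the series [h] by the other
    linear factors, a polynomial of degree less than [m]. *)
Lemma power_expansion j e :
  y j ^+ e = \sum_(r < m) (others j)`_r * shifted h e r.
Proof.
rewrite sum_shifted // -(@coef_mul_trunc _ _ _ e.+1) //.
have coefE N i : (i < N)%N -> (others j * \poly_(a < N) h a)`_i = y j ^+ i.
  elim: i => [|i IHi] ltiN.
    have := hP 0; rewrite -(@coef_mul_trunc _ _ _ N) // (bigD1 j) //= -mulrA.
    by rewrite mulrBl mul1r coefB -scalerAl coefZ coefXM mulr0 subr0.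
  have := hP i.+1; rewrite -(@coef_mul_trunc _ _ _ N) // (bigD1 j) //= -mulrA.
  rewrite mulrBl mul1r coefB -scalerAl coefZ coefXM /= IHi ?(ltnW ltiN) //.
  by move/eqP; rewrite subr_eq0 => /eqP ->; rewrite exprS.
exact/esym/coefE.
Qed.

(** By [power_expansion] the matrix of an alternant is the Jacobi-Trudi matrix
    times a matrix that does not depend on the partition; the empty partition
    identifies the determinant of the latter. *)
Lemma bialternant la : alternant la = jacobi_trudi h m la * alternant [::].
Proof.
pose E := \matrix_(r < m, j < m) (others j)`_(m.-1 - r).
have factor mu : alternant mu = jacobi_trudi h m mu * \det E.
  rewrite /jacobi_trudi -det_mulmx; congr (\det _).
  apply/matrixP => a j; rewrite !mxE power_expansion.
  rewrite (reindex_inj rev_ord_inj); apply: eq_bigr => r _ /=; rewrite !mxE mulrC.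
  have lta := ltn_ord a; have ltr := ltn_ord r.
  congr (_ * _); last by congr (_`__); lia.
  rewrite -(shiftedD _ (r + a)) -[RHS](shiftedD _ m.-1); congr shifted; lia.
have h0 : h 0 = 1.
  by have := hP 0; rewrite big_ord1 subn0 coef0_linear_factors mul1r.
by rewrite !factor (@jacobi_trudi_pad _ h [::]) // [jacobi_trudi h (size [::]) _]det_mx00 mul1r.
Qed.

End Bialternant.

Lemma alternant0_neq0 (R : idomainType) m (y : 'I_m -> R) :
  injective y -> alternant y [::] != 0.
Proof.
move=> y_inj; rewrite /alternant.
have -> : \matrix_(a < m, j < m) y j ^+ (nth 0%N [::] a + (m.-1 - a)) =
    row_perm (perm rev_ord_inj) (Vandermonde m (\row_j y j)).
  apply/matrixP => a j; rewrite !mxE permE nth_nil add0n /=; congr (_ ^+ _).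
  by have := ltn_ord a; lia.
rewrite row_permE det_mulmx det_perm mulf_neq0 ?signr_eq0 // det_Vandermonde.
apply/prodf_neq0 => i _; apply/prodf_neq0 => j ltij.
by rewrite !mxE subr_eq0; apply: contraTneq ltij => /y_inj ->; rewrite ltnn.
Qed.

(** * Partitions in a box *)

Lemma geq_transitive : transitive geq.
Proof. by move=> a b c /= leab lebc; apply: leq_trans lebc leab. Qed.

Lemma nth_leq_head (s : seq nat) i : sorted geq s -> (nth 0%N s i <= head 0%N s)%N.
Proof.
case: s i => [|x s] [|i] //= ps; have [lti|gei] := ltnP i (size s).
  by have /allP/(_ _ (mem_nth 0%N lti)) := order_path_min geq_transitive ps.
by rewrite nth_default.
Qed.

Lemma intpart_sorted (la : intpart) : sorted geq la.
Proof. by case: la => s /= /andP[]. Qed.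

Lemma intpart_pos (la : intpart) : 0%N \notin (la : seq nat).
Proof. by case: la => s /= /andP[]. Qed.

Section Boxes.
Variables m K : nat.
Implicit Type f : {ffun 'I_m -> 'I_(m + K)}.

(** Strictly decreasing maps [f] encode partitions with at most [m] parts, all
    at most [K]: subtract the staircase [m - 1, .., 1, 0]. *)
Definition row_lengths f : seq nat := [seq (f a - (m.-1 - a))%N | a : 'I_m].

Lemma decreasing_geq f (a : 'I_m) : decreasing f -> (m.-1 - a <= f a)%N.
Proof.
move=> df; have lta := ltn_ord a.
suff H c (b : 'I_m) : (b + c = m.-1)%N -> (c <= f b)%N by apply: H; lia.
elim: c b => // c IHc b bc; have ltb : (b.+1 < m)%N by lia.
apply: leq_ltn_trans (IHc (Ordinal ltb) _) _; first by rewrite /=; lia.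
by rewrite (decreasing_ltn _ _ df) /=.
Qed.

Lemma nth_row_lengths f (a : 'I_m) :
  nth 0%N (row_lengths f) a = (f a - (m.-1 - a))%N.
Proof.
have lta := ltn_ord a.
by rewrite (nth_map a) ?size_enum_ord // nth_ord_enum.
Qed.

Lemma sorted_row_lengths f : decreasing f -> sorted geq (row_lengths f).
Proof.
move=> df; apply/(sortedP 0%N) => i; rewrite size_map size_enum_ord => ltSi.
have lti := ltnW ltSi.
rewrite (nth_row_lengths f (Ordinal lti)) (nth_row_lengths f (Ordinal ltSi)) /=.
have := decreasing_geq (Ordinal ltSi) df.
have : (f (Ordinal ltSi) < f (Ordinal lti))%N by rewrite (decreasing_ltn _ _ df) /=.
by rewrite /=; lia.
Qed.

Lemma nonzero_rows_is_intpart f : decreasing f ->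
  is_intpart [seq r <- row_lengths f | (0 < r)%N].
Proof.
move=> df; rewrite /is_intpart mem_filter andbT sorted_filter ?sorted_row_lengths //.
exact: geq_transitive.
Qed.

(** The default value of [insubd] is reached only when [f] is not decreasing. *)
Definition partition_of f : intpart := insubd (IntPart (isT : is_intpart [::]))
  [seq r <- row_lengths f | (0 < r)%N].

(** The zeros of a nonincreasing list are at its end, where they coincide with
    the default value of [nth]. *)
Lemma nth_filter_positive (s : seq nat) i : sorted geq s ->
  nth 0%N [seq r <- s | (0 < r)%N] i = nth 0%N s i.
Proof.
elim: s i => [|[|x] s IHs] i //= ps; last first.
  by case: i => [|i] //=; rewrite IHs // (path_sorted ps).
have s0 : all (pred1 0%N) s.
  by apply: sub_all (order_path_min geq_transitive ps) => x /=; rewrite leqn0.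
have -> : [seq r <- s | (0 < r)%N] = [::].
  by apply/eqP; rewrite -(negbK (_ == _)) -has_filter -all_predC; apply: sub_all s0 => x /= /eqP->.
rewrite nth_nil; case: i => [|i] //=; have [lti|gei] := ltnP i (size s).
  by apply/esym/eqP; have /allP/(_ _ (mem_nth 0%N lti)) := s0.
by rewrite nth_default.
Qed.

Lemma nth_partition_of f (a : 'I_m) : decreasing f ->
  (nth 0%N (partition_of f) a + (m.-1 - a) = f a)%N.
Proof.
move=> df; rewrite val_insubd nonzero_rows_is_intpart //.
rewrite nth_filter_positive ?sorted_row_lengths // nth_row_lengths.
by rewrite subnK // decreasing_geq.
Qed.

Lemma size_partition_of f : decreasing f -> (size (partition_of f) <= m)%N.
Proof.
move=> df; rewrite val_insubd nonzero_rows_is_intpart // size_filter.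
by apply: leq_trans (count_size _ _) _; rewrite size_map size_enum_ord.
Qed.

Definition box_partitions : seq intpart :=
  [seq partition_of f | f in @decreasing m (m + K)].

Lemma big_box_partitions (V : nmodType) (F : intpart -> V) :
  \sum_(la <- box_partitions) F la =
  \sum_(f : {ffun 'I_m -> 'I_(m + K)} | decreasing f) F (partition_of f).
Proof. exact: big_image. Qed.

Lemma box_partitions_uniq : uniq box_partitions.
Proof.
rewrite map_inj_in_uniq ?enum_uniq // => f g; rewrite !mem_enum => df dg eqfg.
apply/ffunP => a; apply: val_inj => /=.
by rewrite -(nth_partition_of a df) -(nth_partition_of a dg) eqfg.
Qed.

Lemma mem_box_partitions (la : intpart) :
  (size la <= m)%N -> (head 0%N la <= K)%N -> la \in box_partitions.
Proof.
move=> szla hdla; have la_sorted := intpart_sorted la.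
have nthK a : (nth 0%N la a <= K)%N := leq_trans (nth_leq_head a la_sorted) hdla.
have f_lt (a : 'I_m) : (nth 0%N la a + (m.-1 - a) < m + K)%N.
  have := nthK a; have := ltn_ord a; lia.
pose f : {ffun 'I_m -> 'I_(m + K)} := [ffun a => Ordinal (f_lt a)].
have nth_mono a b : (a < b)%N -> (nth 0%N la b <= nth 0%N la a)%N.
  move=> ltab; have [ltb|geb] := ltnP b (size la); last by rewrite nth_default.
  by apply: (sorted_ltn_nth geq_transitive 0%N la_sorted); rewrite ?inE //; apply: ltn_trans ltb.
have df : decreasing f.
  apply/decreasingP => a b ltab; rewrite !ffunE /=.
  by have := nth_mono _ _ ltab; have := ltn_ord b; lia.
apply/mapP; exists f; first by rewrite mem_enum; exact: df.
apply: val_inj; rewrite val_insubd nonzero_rows_is_intpart //=.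
have rowsE : row_lengths f = la ++ nseq (m - size la) 0%N.
  apply: (@eq_from_nth _ 0%N) => [|a].
    by rewrite size_map size_enum_ord size_cat size_nseq subnKC.
  rewrite size_map size_enum_ord => lta.
  rewrite (nth_row_lengths f (Ordinal lta)) ffunE /= addnK nth_cat nth_nseq.
  by case: ltnP => // gea; rewrite nth_default // if_same.
rewrite rowsE filter_cat filter_nseq /= cats0; apply/esym/all_filterP/allP => x xla.
by rewrite lt0n; apply: contraNneq (intpart_pos la) => <-.
Qed.

End Boxes.

(** * Cauchy's identity for a polynomial *)

(** The determinant of the Toeplitz matrix of [P] times the matrix of the powers
    of the variables is computed in two ways: directly, and by Cauchy-Binet.
    The Vandermonde determinant is then cancelled, which is possible since the
    variables of a polynomial ring over a domain are distinct. *)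
Lemma finite_Cauchy (R : idomainType) m K (P : {poly R}) :
    P`_0 = 1 -> (size P <= K.+1)%N ->
  \sum_(la <- box_partitions m K)
     jacobi_trudi (fun r => P`_r) (size la) la *: schur R m la =
  \prod_(k < m) (map_poly (@mpolyC m R) P).['X_k].
Proof.
move=> P0 szP; pose y (k : 'I_m) : {mpoly R[m]} := 'X_k.
pose Q := map_poly (@mpolyC m R) P; pose h := hsym R m.
have Q0 : Q`_0 = 1 by rewrite coef_map P0.
have y_inj : injective y.
  move=> i j /(congr1 (mcoeff U_(j)))/eqP; rewrite !mcoeffXU eqxx.
  by case: (eqVneq i j) => // _; rewrite eq_sym oner_eq0.
have hP : inverse_series (\prod_(k < m) (1 - y k *: 'X)) h by exact: hsym_inverse.
have h0 : h 0%N = 1.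
  apply/mpolyP => v; rewrite mcoeff_hsym mcoeff1.
  by rewrite mdeg_eq0.
pose M := \matrix_(i < m, p < m + K) shifted (fun r => Q`_r) p (m.-1 - i).
pose N := \matrix_(p < m + K, j < m) y j ^+ p.
have MN : \det (M *m N) = alternant y [::] * \prod_k Q.[y k].
  have -> : M *m N = (\matrix_(i, j) y j ^+ (nth 0%N [::] i + (m.-1 - i)))
      *m diag_mx (\row_j Q.[y j]).
    apply/matrixP => i j; rewrite mul_mx_diag !mxE nth_nil add0n.
    under eq_bigr do rewrite !mxE.
    rewrite -(big_mkord xpredT
      (fun p => shifted (fun r => Q`_r) p (m.-1 - i) * y j ^+ p)) /=.
    (* row i of M is the coefficient list of P shifted by q *)
    have lti := ltn_ord i; set q := (m.-1 - i)%N.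
    have le_q : (q <= m + K)%N by rewrite /q; lia.
    rewrite (big_cat_nat _ le_q) //= big_nat big1 ?add0r; last first.
      by move=> p /andP[_ ltp]; rewrite /shifted leqNgt ltp mul0r.
    rewrite -{1}[q]add0n big_addn (horner_coef_wide _ (_ : size Q <= m + K - q)%N).
      rewrite big_distrr /= big_mkord; apply: eq_bigr => p _.
      rewrite /shifted leq_addl addnK exprD; ring.
    apply: leq_trans (size_poly _ _) (leq_trans szP _); rewrite /q; lia.
  rewrite det_mulmx det_diag; congr (_ * _).
  by apply: eq_bigr => j _; rewrite mxE.
have := MN; rewrite Cauchy_Binet mulrC => CB.
apply: (mulIf (alternant0_neq0 y_inj)).
rewrite -CB big_box_partitions big_distrl /=; apply: eq_bigr => f df.
set la := partition_of f; have szla : (size la <= m)%N := size_partition_of df.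
have -> : \det (colsub f M) = (jacobi_trudi (fun r => P`_r) (size la) la)%:MP.
  rewrite -(jacobi_trudi_pad P0 szla) (jacobi_trudi_map (@mpolyC m R)).
  rewrite -det_tr; congr (\det _); apply/matrixP => a i; rewrite !mxE.
  rewrite -(nth_partition_of a df) -/la.
  have lti := ltn_ord i; have lta := ltn_ord a.
  rewrite -(shiftedD _ (i + a)) -[RHS](shiftedD _ m.-1) /shifted coef_map /=.
  by congr (if _ then _ else 0); first lia; congr ((P`__)%:MP); lia.
have -> : \det (rowsub f N) = alternant y la.
  by congr (\det _); apply/matrixP => a j; rewrite !mxE nth_partition_of.
rewrite (bialternant hP) -mul_mpolyC mulrA; congr (_ * _ * _).
by rewrite jacobi_trudi_pad.
Qed.

(** * Signs of permutations and conjugate partitions *)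

(** The sign of [s] is the ratio of the Vandermonde determinants of the integers
    [s 0, s 1, ..] and [0, 1, ..], so it is read off the signs of the
    differences [s b - s a]. *)
Lemma odd_perm_inversions n (s : 'S_n) :
  odd_perm s = odd (\sum_(a < n) \sum_(b < n | (a < b)%N) (s b < s a)%N)%N.
Proof.
apply: (@Num.Theory.signr_inj int); rewrite signr_odd expr_sum.
under eq_bigr do rewrite expr_sum.
pose v (t : 'S_n) : 'rV[int]_n := \row_i (t i)%:Z.
have detV (t : 'S_n) : \det (Vandermonde n (v t)) =
    \prod_(a < n) \prod_(b < n | (a < b)%N) ((t b)%:Z - (t a)%:Z).
  by rewrite det_Vandermonde; apply: eq_bigr => a _; apply: eq_bigr => b _; rewrite !mxE.
have : \det (Vandermonde n (v s)) = (-1) ^+ s * \det (Vandermonde n (v 1%g)).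
  have -> : Vandermonde n (v s) = col_perm s (Vandermonde n (v 1%g)).
    by apply/matrixP => i j; rewrite !mxE perm1.
  by rewrite col_permE det_mulmx det_perm odd_permV mulrC.
rewrite !detV => /(congr1 Num.sg).
have sgp := big_morph Num.sg (@Num.Theory.sgrM int) (Num.Theory.sgr1 int).
rewrite Num.Theory.sgrM Num.Theory.sgrX Num.Theory.sgrN1 !sgp.
under [X in _ = _ * X]eq_bigr => a _.
  rewrite sgp big1; first over.
  by move=> b ltab; rewrite !perm1 Num.Theory.gtr0_sg //; lia.
rewrite big1_eq mulr1 => <-; apply: eq_bigr => a _; rewrite sgp.
apply: eq_bigr => b ltab; have neq : (s a : nat) != s b.
  by apply: contraTneq ltab => /val_inj/perm_inj ->; rewrite ltnn.
case: ltnP => cmp; first by rewrite Num.Theory.ltr0_sg //; lia.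
by rewrite Num.Theory.gtr0_sg //; lia.
Qed.

(** A cell lies in the diagram of a partition if and only if the transposed cell
    lies in the diagram of its conjugate. *)
Lemma ltn_count_gt (la : seq nat) i j : sorted geq la ->
  (i < count (fun r => j < r)%N la)%N = (j < nth 0%N la i)%N.
Proof.
elim: la i => [|x s IHs] i ps /=; first by rewrite nth_nil.
have [ltjx|lexj] := ltnP j x.
  by case: i => [|i] //=; rewrite add1n ltnS IHs // (path_sorted ps).
rewrite add0n (@eq_in_count _ _ pred0) ?count_pred0; last first.
  move=> r rs /=; apply/negbTE; rewrite -leqNgt.
  by have /allP/(_ _ rs) /= := order_path_min geq_transitive ps; lia.
by apply/esym/negbTE; rewrite -leqNgt (leq_trans (nth_leq_head i ps)).
Qed.

Section Conjugate.
Variable la : intpart.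

Lemma size_conj_part : size (conj_part la) = head 0%N la.
Proof. by rewrite size_mkseq. Qed.

Lemma ltn_nth_conj_part i j :
  (i < nth 0%N (conj_part la) j)%N = (j < nth 0%N la i)%N.
Proof.
have [ltj|gej] := ltnP j (head 0%N la).
  by rewrite nth_mkseq // ltn_count_gt // intpart_sorted.
rewrite nth_default ?size_mkseq // ltn0; apply/esym/negbTE; rewrite -leqNgt.
exact: leq_trans (nth_leq_head i (intpart_sorted la)) gej.
Qed.

End Conjugate.

(** The parts being positive, the zeros read by [nth] beyond the end determine
    the number of parts. *)
Lemma eq_intpart (la mu : intpart) :
  (forall i, nth 0%N la i = nth 0%N mu i) -> la = mu.
Proof.
move=> eq_nth.
have size_le (al be : intpart) : (forall i, nth 0%N al i = nth 0%N be i) ->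
    (size al <= size be)%N.
  move=> eqab; rewrite leqNgt; apply/negP => lt_size.
  have := mem_nth 0%N lt_size; rewrite eqab nth_default //.
  by rewrite (negbTE (intpart_pos al)).
apply/val_inj/(@eq_from_nth _ 0%N) => [|i _]; last exact: eq_nth.
by apply/eqP; rewrite eqn_leq !size_le.
Qed.

Lemma conj_partK : involutive conj_part.
Proof.
move=> la; apply: eq_intpart => i; apply/eqP; rewrite eqn_leq.
have le_nth (al be : intpart) : (forall j, (j < nth 0%N al i)%N = (j < nth 0%N be i)%N) ->
    (nth 0%N al i <= nth 0%N be i)%N.
  by move=> eqlt; rewrite leqNgt eqlt ltnn.
by rewrite !le_nth // => j; rewrite !ltn_nth_conj_part.
Qed.

(** * The dual Jacobi-Trudi formula *)

Section DualJacobiTrudi.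
Variables (A : comNzRingType) (P : {poly A}) (h : nat -> A).
Hypotheses (P0 : P`_0 = 1) (hP : inverse_series P h).

(** These are the coefficients of [P(- t)]; for the product of the [1 - y_k t]
    they are the elementary symmetric polynomials. *)
Definition signed_coef r : A := (-1) ^+ r * P`_r.

Let toeplitz n (g : nat -> A) : 'M[A]_n := \matrix_(a, b) shifted g a b.

Lemma det_toeplitz n (g : nat -> A) : g 0%N = 1 -> \det (toeplitz n g) = 1.
Proof.
move=> g0; rewrite det_trig; last first.
  by apply/is_trig_mxP => a b ltab; rewrite mxE /shifted leqNgt ltab.
by rewrite big1 // => a _; rewrite mxE /shifted leqnn subnn.
Qed.

Lemma toeplitz_mul n : toeplitz n h *m toeplitz n (fun r => P`_r) = 1%:M.
Proof.
apply/matrixP => a b; rewrite !mxE.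
under eq_bigr do rewrite !mxE.
rewrite -(big_mkord xpredT (fun c => shifted h a c * shifted (fun r => P`_r) c b)) /=.
have lta := ltn_ord a; have ltb := ltn_ord b.
rewrite (big_cat_nat _ (ltnW ltb)) //= big_nat big1 ?add0r; last first.
  by move=> c /andP[_ ltc]; rewrite {2}/shifted leqNgt ltc mulr0.
rewrite -{1}[b : nat]add0n big_addn big_mkord.
have [ltab|leba] := ltnP a b.
  rewrite big1 => [|c _].
    by case: eqP => // eqab; rewrite eqab ltnn in ltab.
  by rewrite {1}/shifted leqNgt ltn_addl ?mul0r.
transitivity (\sum_(c < n - b | (c < (a - b).+1)%N) P`_c * h (a - b - c)%N).
  rewrite [RHS]big_mkcond; apply: eq_bigr => c _.
  rewrite {2}/shifted leq_addl addnK mulrC.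
  rewrite -{1}(subnK leba) shiftedD /shifted ltnS.
  by case: leqP => // _; rewrite mulr0.
rewrite -(big_ord_widen _ (fun c => P`_c * h (a - b - c)%N)); last by lia.
rewrite hP; congr (_%:R); rewrite -val_eqE /=.
by apply/eqP; case: eqP; lia.
Qed.

Variable la : intpart.
Let l := size la.
Let k := head 0%N la.
Let mu := conj_part la.

Lemma nth_conj_part_leq j : (nth 0%N mu j <= l)%N.
Proof. by rewrite leqNgt ltn_nth_conj_part nth_default. Qed.

(** The vertical and horizontal steps of the boundary path of the diagram of
    [la], numbered from its lower left end: the first [l] values number the
    vertical steps, the last [k] the horizontal ones.  Together they number all
    steps, hence form a permutation of [0 .. l + k - 1] (see [beta_inj]). *)
Definition beta (x : 'I_(l + k)) : nat :=
  match split x with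
  | inl i => nth 0%N la (l.-1 - i) + i
  | inr j => l + j - nth 0%N mu j
  end.

Lemma beta_lt x : (beta x < l + k)%N.
Proof.
rewrite /beta; case: split => [i|j].
  have := nth_leq_head (l.-1 - i) (intpart_sorted la); have := ltn_ord i; rewrite /k; lia.
have := ltn_ord j; lia.
Qed.

Lemma beta_lshift_mono (i j : 'I_l) : (i < j)%N ->
  (beta (lshift k i) < beta (lshift k j))%N.
Proof.
move=> ltij; rewrite /beta !(unsplitK (inl _)).
have : (nth 0%N la (l.-1 - i) <= nth 0%N la (l.-1 - j))%N.
  rewrite leqNgt -ltn_nth_conj_part -leqNgt.
  have : (nth 0%N la (l.-1 - j) <= nth 0%N la (l.-1 - j))%N by [].
  rewrite leqNgt -ltn_nth_conj_part -leqNgt.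
  have := ltn_ord i; have := ltn_ord j; lia.
lia.
Qed.

Lemma beta_rshift_mono (i j : 'I_k) : (i < j)%N ->
  (beta (rshift l i) < beta (rshift l j))%N.
Proof.
move=> ltij; rewrite /beta !(unsplitK (inr _)).
have : (nth 0%N mu j <= nth 0%N mu i)%N.
  rewrite leqNgt ltn_nth_conj_part -leqNgt.
  have : (nth 0%N mu i <= nth 0%N mu i)%N by [].
  rewrite leqNgt ltn_nth_conj_part -leqNgt; lia.
have := nth_conj_part_leq i; have := nth_conj_part_leq j; lia.
Qed.

(** The cell in row [l - 1 - i] and column [j] belongs to the diagram exactly
    when the horizontal step of its column comes before the vertical step of its
    row. *)
Lemma beta_cross (i : 'I_l) (j : 'I_k) :
  if (l.-1 - i < nth 0%N mu j)%N then (beta (rshift l j) < beta (lshift k i))%N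
  else (beta (lshift k i) < beta (rshift l j))%N.
Proof.
rewrite /beta (unsplitK (inl _)) (unsplitK (inr _)).
have := ltn_nth_conj_part la (l.-1 - i) j; rewrite -/mu.
have := nth_conj_part_leq j; have := ltn_ord i.
case: (ltnP (l.-1 - i) (nth 0%N mu j)) => [lt_mu|ge_mu]; lia.
Qed.

Lemma beta_inj : injective beta.
Proof.
move=> x y; rewrite -(splitK x) -(splitK y).
have mono_inj n (f : 'I_n -> nat) : (forall i j : 'I_n, (i < j)%N -> (f i < f j)%N) ->
    injective f.
  move=> mono i j eqf; apply: val_inj; case: (ltngtP i j) => // /mono; by rewrite eqf ltnn.
case: (split x) => i; case: (split y) => j /=.
- by move/(mono_inj _ (fun i => beta (lshift k i)) beta_lshift_mono) ->.
- by have := beta_cross i j; case: ifP => _ + eqb; rewrite eqb ltnn.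
- by have := beta_cross j i; case: ifP => _ + eqb; rewrite eqb ltnn.
- by move/(mono_inj _ (fun i => beta (rshift l i)) beta_rshift_mono) ->.
Qed.

Lemma beta_ord_inj : injective (fun x => Ordinal (beta_lt x)).
Proof. by move=> x y /(congr1 val) /= /beta_inj. Qed.

Definition beta_perm : 'S_(l + k) := perm beta_ord_inj.

Lemma beta_permE x : beta_perm x = beta x :> nat.
Proof. by rewrite permE. Qed.

(** By [beta_cross] the inversions of the permutation are the cells of the
    diagram, counted here by columns. *)
Lemma odd_beta_perm : odd_perm beta_perm = odd (\sum_(j < k) nth 0%N mu j)%N.
Proof.
rewrite odd_perm_inversions; congr odd.
rewrite big_split_ord /= [X in (_ + X)%N]big1 ?addn0 => [|j _]; last first.
  rewrite big_mkcond big_split_ord /= !big1 // => i _ /=; last first.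
    by rewrite ltnNge (leq_trans (ltnW (ltn_ord i)) (leq_addr _ _)).
  case: ifP => //; rewrite ltn_add2l => ltij.
  by rewrite !beta_permE ltnNge ltnW ?beta_rshift_mono.
transitivity (\sum_(i < l) \sum_(j < k) (l.-1 - i < nth 0%N mu j)%N)%N.
  apply: eq_bigr => i _; rewrite big_mkcond big_split_ord /= big1 ?add0n => [|j _].
    apply: eq_bigr => j _; rewrite ltn_addr ?ltn_ord // !beta_permE.
    by have := beta_cross i j; case: ltnP => // _ lt_b; rewrite ?lt_b // ltnNge ltnW.
  by case: ifP => // ltij; rewrite !beta_permE ltnNge ltnW ?beta_lshift_mono.
rewrite exchange_big; apply: eq_bigr => j _ /=.
rewrite (reindex_inj rev_ord_inj) /=.
rewrite (eq_bigr (fun i : 'I_l => ((i < nth 0%N mu j)%N : nat))) => [|i _].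
  rewrite -big_mkcond sum1_card /=.
  have -> : #|[pred i : 'I_l | (i < nth 0%N mu j)%N]| = nth 0%N mu j.
    rewrite -sum1_card (eq_bigl (fun i : 'I_l => (i < nth 0%N mu j)%N)) //.
    rewrite -(big_ord_widen l (fun=> 1%N)) ?nth_conj_part_leq //.
    by rewrite sum_nat_const card_ord muln1.
  by [].
by congr (nat_of_bool (_ < _)%N); have := ltn_ord i; lia.
Qed.

(** Jacobi's theorem on complementary minors.  With its rows permuted by
    [beta_perm], the Toeplitz matrix of [h] has the Jacobi-Trudi matrix of [la],
    with rows and columns reversed, as its upper left block; its inverse is the
    Toeplitz matrix of [P] with permuted columns.  The upper left minor of a
    matrix is its determinant times the lower right minor of the inverse. *)
Lemma jacobi_trudi_inverse_minor :
  jacobi_trudi h l la =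
  (-1) ^+ (\sum_(j < k) nth 0%N mu j)%N *
  \det (\matrix_(i < k, j < k) shifted (fun r => P`_r) (nth 0%N mu j + i) j).
Proof.
have h0 : h 0%N = 1 by have := hP 0; rewrite big_ord1 P0 mul1r.
pose W := row_perm beta_perm (toeplitz (l + k) h).
pose W' := col_perm beta_perm (toeplitz (l + k) (fun r => P`_r)).
have WW' : W *m W' = 1%:M.
  rewrite /W /W' row_permE col_permE mulmxA -(mulmxA _ (toeplitz _ h)) toeplitz_mul.
  by rewrite mulmx1 -perm_mxM mulgV perm_mx1.
have detW : \det W = (-1) ^+ (\sum_(j < k) nth 0%N mu j)%N.
  rewrite /W row_permE det_mulmx det_perm det_toeplitz // mulr1.
  by rewrite odd_beta_perm signr_odd.
have := congr1 (fun X => ulsubmx X) WW'.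
have := congr1 (fun X => ursubmx X) WW'.
have := congr1 (fun X => dlsubmx X) WW'.
have := congr1 (fun X => drsubmx X) WW'.
rewrite -{1 2 3 4}[W]submxK -{1 2 3 4}[W']submxK mulmx_block scalar_mx_block.
rewrite !block_mxKul !block_mxKur !block_mxKdl !block_mxKdr => eq_dr eq_dl eq_ur eq_ul.
(* keeping only the right half of the inverse makes both sides triangular *)
have : W *m block_mx 1%:M (ursubmx W') 0 (drsubmx W') =
    block_mx (ulsubmx W) 0 (dlsubmx W) 1%:M.
  rewrite -{1}[W]submxK mulmx_block !mulmx1 !mulmx0 !addr0.
  by rewrite eq_ur eq_dr.
move/(congr1 determinant); rewrite det_mulmx det_ublock det_lblock !det1 mul1r mulr1 detW.
have -> : \det (ulsubmx W) = jacobi_trudi h l la.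
  have -> : ulsubmx W = row_perm (perm rev_ord_inj) (col_perm (perm rev_ord_inj)
      (\matrix_(i < l, j < l) shifted h (nth 0%N la i + j) i)).
    apply/matrixP => i j; rewrite !mxE beta_permE /beta (unsplitK (inl _)) !permE /=.
    have lti := ltn_ord i; have ltj := ltn_ord j.
    rewrite (_ : l.-1 - i = l - i.+1)%N; last by lia.
    rewrite -(shiftedD _ (l - j.+1)) -[RHS](shiftedD _ i); congr shifted; lia.
  rewrite row_permE col_permE !det_mulmx mulrCA -det_mulmx -perm_mxM mulgV perm_mx1.
  by rewrite det1 mulr1.
move=> <-; congr (_ * \det _); apply/matrixP => i j.
rewrite !mxE beta_permE /beta (unsplitK (inr _)).
rewrite -(shiftedD _ (nth 0%N mu j)) -[RHS](shiftedD _ l).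
by have le_mu := nth_conj_part_leq j; congr shifted; move: le_mu; rewrite /rshift /=; lia.
Qed.

(** The signs of [signed_coef] come from diagonal matrices on both sides of the
    matrix of the coefficients of [P]; their determinants multiply to the sign
    in [jacobi_trudi_inverse_minor]. *)
Lemma dual_jacobi_trudi :
  jacobi_trudi h (size la) la =
  jacobi_trudi signed_coef (size (conj_part la)) (conj_part la).
Proof.
rewrite [LHS]jacobi_trudi_inverse_minor size_conj_part -/k -/mu.
rewrite -det_tr /jacobi_trudi; set M := (X in \det X).
have -> : \matrix_(i < k, j < k) shifted signed_coef (nth 0%N mu i + j) i =
    diag_mx (\row_i (-1) ^+ (nth 0%N mu i + i)) *m M *m diag_mx (\row_j (-1) ^+ j).
  apply/matrixP => i j; rewrite mul_mx_diag mul_diag_mx !mxE.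
  rewrite /shifted; case: leqP => [le_i|]; last by rewrite mulr0 mul0r.
  rewrite /signed_coef mulrAC -exprD; congr (_ * _).
  rewrite -signr_odd -[RHS]signr_odd; congr (_ ^+ nat_of_bool _).
  by rewrite oddB // !oddD addbAC.
rewrite !det_mulmx !det_diag mulrAC; congr (_ * _).
under eq_bigr do rewrite mxE; under [X in _ = _ * X]eq_bigr do rewrite mxE.
rewrite -!expr_sum -exprD big_split /= -addnA addnn exprD.
by rewrite -[in X in _ = _ * X]signr_odd odd_double expr0 mulr1.
Qed.

End DualJacobiTrudi.

(** * Polynomials that vanish at natural points *)

Lemma digits_inj D m (a b : 'I_m -> nat) :
    (forall k, (a k < D)%N) -> (forall k, (b k < D)%N) ->
    (\sum_(k < m) a k * D ^ k = \sum_(k < m) b k * D ^ k)%N ->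
  a =1 b.
Proof.
elim: m a b => [|m IHm] a b ltaD ltbD; first by move=> _ [].
have D_gt0 : (0 < D)%N by apply: leq_ltn_trans (ltaD ord0).
have shift (c : 'I_m.+1 -> nat) : (\sum_(k < m.+1) c k * D ^ k =
    (\sum_(k < m) c (lift ord0 k) * D ^ k) * D + c ord0)%N.
  rewrite big_ord_recl expn0 muln1 addnC big_distrl; congr (_ + _)%N.
  by apply: eq_bigr => k _ /=; rewrite expnSr mulnA.
rewrite !shift => eq_sum.
have eq0 : a ord0 = b ord0.
  by have := congr1 (modn^~ D) eq_sum; rewrite !modnMDl !modn_small.
have eqS : forall k, a (lift ord0 k) = b (lift ord0 k).
  apply: IHm => //; move/eqP: eq_sum.
  by rewrite eq0 eqn_add2r eqn_pmul2r // => /eqP.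
by move=> k; case: (unliftP ord0 k) => [j|] ->.
Qed.

(** Kronecker's substitution [x_k = t ^ (D ^ k)], with [D] above all exponents,
    turns [p] into a univariate polynomial with the same coefficients, because
    exponents become numbers written in base [D].  It vanishes at all natural
    [t], which are again natural points. *)
Lemma mpoly_nat_points_eq0 (R : idomainType) m (p : {mpoly R[m]}) :
    injective (fun i : nat => i%:R : R) ->
    (forall x : 'I_m -> nat, p.@[fun k => (x k)%:R] = 0) ->
  p = 0.
Proof.
move=> nat_inj p0; pose D := msize p.
pose wt (u : 'X_{1..m}) := (\sum_(k < m) u k * D ^ k)%N.
pose q : {poly R} := \sum_(u <- msupp p) p@_u *: 'X^(wt u).
have lt_D u k : u \in msupp p -> (u k < D)%N.
  move/msize_mdeg_lt; apply: leq_ltn_trans.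
  by rewrite mdegE (bigD1 k) //= leq_addr.
have q_root t : q.[t%:R] = 0.
  rewrite -(p0 (fun k => t ^ (D ^ k))%N) mevalE horner_sum.
  apply: eq_bigr => u _; rewrite hornerZ hornerXn; congr (_ * _).
  rewrite /wt expr_sum; apply: eq_bigr => k _.
  by rewrite mulnC exprM natrX.
have q0 : q = 0.
  apply/eqP; apply: contraT => nzq.
  have := @max_poly_roots _ q [seq t%:R | t <- iota 0 (size q)] nzq.
  rewrite size_map size_iota ltnn; apply.
    by apply/allP => _ /mapP[t _ ->]; rewrite rootE q_root.
  by rewrite map_inj_uniq ?iota_uniq.
apply/mpolyP => v; rewrite mcoeff0; apply/eqP; rewrite mcoeff_eq0.
apply/negP => vp; have := congr1 (fun r : {poly R} => r`_(wt v)) q0.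
rewrite coef0 coef_sum (bigD1_seq v) ?msupp_uniq //= coefZ coefXn eqxx mulr1.
rewrite big_seq_cond big1 ?addr0 => [/eqP|u /andP[up neq]].
  by rewrite mcoeff_eq0 vp.
rewrite coefZ coefXn; case: eqP => [eqw|_]; last by rewrite mulr0.
case/eqP: neq; apply/mnmP; apply: digits_inj (esym eqw) => k; exact: lt_D.
Qed.

Lemma natr_mpoly_inj (R : nzRingType) m : injective (fun i : nat => i%:R : R) ->
  injective (fun i : nat => i%:R : {mpoly R[m]}).
Proof.
by move=> nat_inj i j; rewrite -!mpolyC_nat => /(can_inj (@mpolyCK _ _))/nat_inj.
Qed.

(** * Schur polynomials at reciprocal points *)

Lemma schurE (R : comNzRingType) N (la : intpart) :
  schur R N la = jacobi_trudi (hsym R N) (size la) la.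
Proof. by []. Qed.

Lemma map_schur (R R' : comNzRingType) (phi : {rmorphism R -> R'}) N la :
  map_mpoly phi (schur R N la) = schur R' N la.
Proof.
rewrite !schurE (jacobi_trudi_map (map_mpoly phi)); apply: eq_jacobi_trudi => d /=.
apply/mpolyP => v; rewrite mcoeff_map_mpoly !mcoeff_hsym.
by case: (mdeg v == d); rewrite /= ?rmorph1 ?rmorph0.
Qed.

Lemma schur_size0 (R : comNzRingType) N (la : intpart) :
  (N < size la)%N -> schur R N la = 0.
Proof.
move=> lt_size; rewrite schurE.
apply: (jacobi_trudi_size0 _ (hsym_inverse R N) (intpart_pos la)).
  exact: coef0_linear_factors.
apply: leq_trans lt_size; apply: leq_trans (size_linear_factors _ _) _.
by rewrite card_ord.
Qed.

(** The even and the odd case are treated together: [pt x] is the list of values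
    substituted for the [M] variables of a Schur polynomial, and [P] the
    polynomial in [t] whose value at [z_j = x_j + 1 / x_j] is the product of the
    linear factors attached to [pt x]. *)
Section Specialization.
Variables (C : numClosedFieldType) (N M : nat).
Variable pt : ('I_N -> C) -> 'I_M -> C.
Variable P : {poly {mpoly C[N]}}.

Definition joukowski (x : 'I_N -> C) (j : 'I_N) : C := x j + (x j)^-1.

Definition specialization_of (S : {mpoly C[M]}) : set {mpoly C[N]} :=
  [set Q | Q \is symmetric /\
    forall x : 'I_N -> C, (forall j, x j != 0) -> S.@[pt x] = Q.@[joukowski x]]%classic.

Hypothesis P0 : P`_0 = 1.
Hypothesis P_sym : forall s : 'S_N, map_poly (msym s) P = P.
Hypothesis P_pt : forall x : 'I_N -> C, (forall j, x j != 0) ->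
  map_poly (meval (joukowski x)) P = \prod_(k < M) (1 - pt x k *: 'X).

(** Over an algebraically closed field [x^2 - w x + 1] has a root, and the
    product of its two roots is 1. *)
Lemma joukowski_surj (w : 'I_N -> C) :
  exists2 x : 'I_N -> C, (forall j, x j != 0) & joukowski x =1 w.
Proof.
pose x j := (w j + Num.Theory.sqrtC (w j ^+ 2 - 4)) / 2.
have x_eq j : x j * (w j - x j) = 1.
  have sq := Num.Theory.sqrtCK (w j ^+ 2 - 4); rewrite /x.
  set r := Num.Theory.sqrtC _ in sq *.
  have -> : (w j + r) / 2 * (w j - (w j + r) / 2) = (w j ^+ 2 - r ^+ 2) / 4 by field.
  by rewrite sq; field.
have x_neq0 j : x j != 0.
  by apply: contra_eq_neq (x_eq j) => ->; rewrite mul0r eq_sym oner_eq0.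
exists x => // j; rewrite /joukowski -[w j](subrKC (x j)); congr (_ + _).
by apply: (mulfI (x_neq0 j)); rewrite divff ?x_eq.
Qed.

Lemma natr_numClosed_inj : injective (fun i : nat => i%:R : C).
Proof. by move=> i j /eqP; rewrite Num.Theory.eqr_nat => /eqP. Qed.

(** Two such polynomials agree at every point, by [joukowski_surj]. *)
Lemma specialization_uniq S Q Q' :
  specialization_of S Q -> specialization_of S Q' -> Q = Q'.
Proof.
move=> [_ QS] [_ Q'S]; apply/eqP; rewrite -subr_eq0; apply/eqP.
apply: mpoly_nat_points_eq0; first exact: natr_numClosed_inj.
move=> w; have [x x_neq0 xw] := joukowski_surj (fun k => (w k)%:R).
by rewrite mevalB -!(meval_eq _ xw) -QS // -Q'S // subrr.
Qed.

(** On both sides the determinant is that of the power series inverse to the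
    product of the linear factors of [pt x]. *)
Lemma meval_schur x la : (forall j, x j != 0) ->
  (schur C M la).@[pt x] =
  (jacobi_trudi (inv_coef P) (size la) la).@[joukowski x].
Proof.
move=> x_neq0; rewrite schurE !jacobi_trudi_map; apply: eq_jacobi_trudi.
apply: (@inverse_series_uniq _ (\prod_(k < M) (1 - pt x k *: 'X))).
- exact: coef0_linear_factors.
- have := inverse_series_map (meval (pt x)) (hsym_inverse C M).
  rewrite rmorph_prod; under eq_bigr do rewrite rmorphB rmorph1 /= map_polyZ map_polyX /= mevalXU.
  by [].
by rewrite -P_pt //; apply: inverse_series_map; apply: inv_coefP.
Qed.

Lemma specialization_schur la :
  specialization_of (schur C M la) (jacobi_trudi (inv_coef P) (size la) la).
Proof.
split; last by move=> x x_neq0; rewrite meval_schur.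
apply/issymP => s; rewrite jacobi_trudi_map; apply: eq_jacobi_trudi.
apply: (inverse_series_uniq P0) (inv_coefP P0).
by rewrite -{1}(P_sym s); apply: inverse_series_map; apply: inv_coefP.
Qed.

Lemma xget_specialization la :
  xget 0 (specialization_of (schur C M la)) = jacobi_trudi (inv_coef P) (size la) la.
Proof.
apply: xget_unique; first exact: specialization_schur.
by move=> Q hQ; apply: specialization_uniq hQ (specialization_schur la).
Qed.

End Specialization.

(** * Sums over partitions with finite support *)

Section FiniteSums.
Variable V : nmodType.

Lemma sums_to_seq (I : choiceType) (s : seq I) (F : I -> V) S :
    uniq s -> (forall i, F i != 0 -> i \in s) -> \sum_(i <- s) F i = S ->
  sums_to F S.
Proof.
move=> s_uniq supp <-; split.
  by apply: (@sub_finite_set _ _ [set` s]) => [i /=|]; [exact: supp | exact: finite_seq].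
rewrite (fsbigE s) //= => [|i _ nis].
  by apply: eq_bigl => i; rewrite in_setT.
by apply/eqP; apply: contraNT nis; exact: supp.
Qed.

Lemma box_sums_to m K (F : intpart -> V) S :
    (forall la : intpart, F la != 0 -> (size la <= m)%N && (head 0%N la <= K)%N) ->
    \sum_(la <- box_partitions m K) F la = S ->
  sums_to F S.
Proof.
move=> supp; apply: sums_to_seq (box_partitions_uniq m K) _ => la /supp/andP[].
exact: mem_box_partitions.
Qed.

Lemma conj_box_sums_to m K (F : intpart -> V) S :
    (forall la : intpart, F la != 0 -> (size la <= m)%N && (head 0%N la <= K)%N) ->
    \sum_(la <- box_partitions m K) F la = S ->
  sums_to (fun la => F (conj_part la)) S.
Proof.
move=> supp sumF; apply: (@sums_to_seq _ [seq conj_part la | la <- box_partitions m K]).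
- by rewrite map_inj_uniq ?box_partitions_uniq //; apply: can_inj conj_partK.
- move=> la /supp/andP[szla hdla]; rewrite -[la]conj_partK map_f //.
  exact: mem_box_partitions.
- by rewrite big_map -sumF; apply: eq_bigr => la _; rewrite conj_partK.
Qed.

End FiniteSums.

Section SignedCoefficients.
Variable A : comNzRingType.
Implicit Type P : {poly A}.

Lemma coef_comp_opp P i : (P \Po - 'X)`_i = signed_coef P i.
Proof.
rewrite comp_polyE coef_sum /signed_coef.
have termE (j : nat) : (P`_j *: (- 'X) ^+ j)`_i = (i == j)%:R * ((-1) ^+ j * P`_j).
  by rewrite -scaleN1r exprZn !coefZ coefXn; case: (i == j) => /=; ring.
under eq_bigr do rewrite termE.
have [lti|gei] := ltnP i (size P).
  rewrite (bigD1 (Ordinal lti)) //= eqxx mul1r big1 ?addr0 // => j neqj.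
  by rewrite (_ : i == j = false) ?mul0r //; apply: contra_neqF neqj => /eqP eqij; apply: val_inj.
rewrite big1 => [|j _]; first by rewrite nth_default ?mulr0.
by rewrite gtn_eqF ?mul0r // (leq_trans (ltn_ord j)).
Qed.

Lemma size_comp_opp P : (size (P \Po - 'X)%R <= size P)%N.
Proof.
apply/leq_sizeP => i gei; rewrite coef_comp_opp /signed_coef.
by rewrite nth_default ?mulr0.
Qed.

Lemma horner_map_comp_opp (A' : comNzRingType) (phi : {rmorphism A -> A'}) P y :
  (map_poly phi (P \Po - 'X)).[y] = (map_poly phi P).[- y].
Proof. by rewrite map_comp_poly rmorphN /= map_polyX horner_comp hornerN hornerX. Qed.

End SignedCoefficients.

Lemma meval_map_mpolyC (R : comNzRingType) n k (v : 'I_k -> R) (p : {mpoly R[k]}) :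
  (map_mpoly (@mpolyC n R) p).@[fun j => (v j)%:MP] = (p.@[v])%:MP.
Proof.
elim/mpolyind: p => [|c u q _ _ IHq]; first by rewrite !raddf0.
rewrite (rmorphD (map_mpoly (@mpolyC n R))) mevalD mevalD mpolyCD; congr (_ + _); last exact: IHq.
rewrite /= map_mpolyZ map_mpolyX !mevalZ mpolyCM !mevalX; congr (_ * _).
by rewrite (rmorph_prod (@mpolyC n R)); apply: eq_bigr => j _; rewrite (rmorphXn (@mpolyC n R)).
Qed.

(** * Dual Cauchy identities *)

Section DualIdentities.
Variables (C : numClosedFieldType) (n m : nat).
Local Notation B := {mpoly C[n]}.
Variable P : {poly B}.
Hypothesis P0 : P`_0 = 1.

Let e : nat -> B := signed_coef P.

Lemma dual_Cauchy_box M K : (size P <= K.+1)%N ->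
  \sum_(la <- box_partitions M K) (jacobi_trudi e (size la) la) *: schur B M la =
  \prod_(k < M) (map_poly (@mpolyC M B) P).[- 'X_k].
Proof.
move=> szP; have Q0 : (P \Po - 'X)`_0 = 1.
  by rewrite coef_comp_opp /signed_coef expr0 mul1r.
transitivity (\prod_(k < M) (map_poly (@mpolyC M B) (P \Po - 'X)).['X_k]).
  rewrite -(finite_Cauchy M Q0 (leq_trans (size_comp_opp P) szP)).
  have -> : e = fun r => (P \Po - 'X)`_r by apply: funext => r; rewrite coef_comp_opp.
  by [].
by apply: eq_bigr => k _; exact: (horner_map_comp_opp (@mpolyC M B)).
Qed.

Lemma signed_minor_support K (la : intpart) : (size P <= K.+1)%N ->
  jacobi_trudi e (size la) la != 0 -> (head 0%N la <= K)%N.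
Proof.
move=> szP; apply: contraNT; rewrite -ltnNge => ltK.
have -> : jacobi_trudi e (size la) la =
    jacobi_trudi (fun r => (P \Po - 'X)`_r) (size la) la.
  by apply: eq_jacobi_trudi => r; rewrite coef_comp_opp.
rewrite jacobi_trudi_head0 //; first by case: (la : seq nat) ltK.
exact: leq_trans (size_comp_opp P) (leq_trans szP ltK).
Qed.

Lemma dual_Cauchy :
  sums_to (fun la : intpart =>
      in_z m (jacobi_trudi (inv_coef P) (size la) la) *
      in_y n (schur C m (conj_part la)))
    (\prod_(k < m) (map_poly (@mpolyC m B) P).[- yvar n k]).
Proof.
pose F (mu : intpart) := jacobi_trudi e (size mu) mu *: schur B m mu.
have -> : (fun la : intpart => in_z m (jacobi_trudi (inv_coef P) (size la) la) *
    in_y n (schur C m (conj_part la))) = fun la => F (conj_part la).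
  apply: funext => la; rewrite /in_z /in_y map_schur mul_mpolyC.
  by rewrite (dual_jacobi_trudi P0 (inv_coefP P0)).
apply: (@conj_box_sums_to _ m (size P)) => [mu|].
  apply: contraNT; rewrite negb_and -!ltnNge => /orP[lt_size|lt_head].
    by rewrite /F schur_size0 // scaler0.
  rewrite /F; suff -> : jacobi_trudi e (size mu) mu = 0 by rewrite scale0r.
  apply/eqP; apply: contraTT lt_head; rewrite -leqNgt; exact: signed_minor_support.
rewrite dual_Cauchy_box //; apply: eq_bigr => k _.
by rewrite /yvar /in_y map_mpolyX.
Qed.

Variables (M : nat) (pt : ('I_m -> C) -> 'I_M -> C) (Q : {poly {mpoly C[m]}}).
Hypothesis Q0 : Q`_0 = 1.
Hypothesis Q_size : (size Q <= M.+1)%N.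
Hypothesis Q_pt : forall x : 'I_m -> C, (forall j, x j != 0) ->
  map_poly (meval (joukowski x)) Q = \prod_(k < M) (1 - pt x k *: 'X).

(** Both sides are polynomials in [y], so it is enough to compare them at the
    points with natural coordinates.  Such a point is [joukowski x], where the
    determinant of [Q] becomes a Schur polynomial in [M] variables evaluated at
    [pt x]. *)
Lemma dual_Cauchy_specialized (T : {mpoly B[m]}) :
    (forall x : 'I_m -> C, (forall j, x j != 0) ->
      T.@[fun j => (joukowski x j)%:MP] = \prod_(k < M) P.[- (pt x k)%:MP]) ->
  sums_to (fun la : intpart =>
      in_z m (jacobi_trudi (inv_coef P) (size la) la) *
      in_y n (jacobi_trudi (inv_coef Q) (size (conj_part la)) (conj_part la))) T.
Proof.
move=> T_pt.
pose F (mu : intpart) := in_z m (jacobi_trudi e (size mu) mu) *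
  in_y n (jacobi_trudi (inv_coef Q) (size mu) mu).
have -> : (fun la : intpart => in_z m (jacobi_trudi (inv_coef P) (size la) la) *
    in_y n (jacobi_trudi (inv_coef Q) (size (conj_part la)) (conj_part la))) =
    fun la => F (conj_part la).
  by apply: funext => la; rewrite (dual_jacobi_trudi P0 (inv_coefP P0)).
apply: (@conj_box_sums_to _ M (size P)) => [mu|].
  apply: contraNT; rewrite negb_and -!ltnNge => /orP[lt_size|lt_head]; rewrite /F.
    rewrite (jacobi_trudi_size0 Q0 (inv_coefP Q0)) ?intpart_pos //.
      by rewrite /in_y rmorph0 mulr0.
    exact: leq_trans Q_size lt_size.
  suff -> : jacobi_trudi e (size mu) mu = 0 by rewrite /in_z rmorph0 mul0r.
  apply/eqP; apply: contraTT lt_head; rewrite -leqNgt; exact: signed_minor_support.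
apply/eqP; rewrite -subr_eq0; apply/eqP; apply: mpoly_nat_points_eq0.
  exact/natr_mpoly_inj/natr_numClosed_inj.
move=> w; have [x x_neq0 xw] := joukowski_surj (fun k => (w k)%:R : C).
have xw' : (fun j => (joukowski x j)%:MP : B) =1 fun k => (w k)%:R.
  by move=> k; rewrite xw mpolyC_nat.
rewrite mevalB -!(meval_eq _ xw') T_pt // rmorph_sum /=.
have := congr1 (meval (fun k => (pt x k)%:MP : B))
  (dual_Cauchy_box M (leqnSn (size P))).
rewrite rmorph_sum rmorph_prod /=.
under [X in _ = X]eq_bigr => k _.
  rewrite -horner_map rmorphN /= mevalXU -map_poly_comp /=.
  rewrite (@map_poly_id _ _ P); first over.
  by move=> a _ /=; rewrite mevalC.
move=> <-; apply/eqP; rewrite subr_eq0; apply/eqP; apply: eq_bigr => mu _.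
rewrite mevalZ mevalM mevalC; congr (_ * _).
have -> : schur B M mu = map_mpoly (@mpolyC n C) (schur C M mu) by rewrite map_schur.
by rewrite /in_y !meval_map_mpolyC (meval_schur Q0 Q_pt).
Qed.

End DualIdentities.

(** * The Cauchy identity for power series *)

Section Homogeneity.
Variables (R : comNzRingType) (m : nat).

Lemma hsym_homog d : hsym R m d \is d.-homog.
Proof.
apply/dhomogP => u; rewrite mcoeff_msupp mcoeff_hsym.
by case: (eqVneq (mdeg u) d) => // _; rewrite eqxx.
Qed.

Lemma prod_homog (I : finType) (F : I -> {mpoly R[m]}) (d : I -> nat) :
  (forall i, F i \is (d i).-homog) -> \prod_i F i \is (\sum_i d i)%N.-homog.
Proof.
move=> hF; apply: (big_ind2 (fun p k => p \is k.-homog)) => //; first exact: dhomog1.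
by move=> p k q l hp hq; apply: dhomogM.
Qed.

(** In the term of the determinant indexed by [s] the degrees
    [la_i + s i - i] add up to the size of [la]. *)
Lemma schur_homog (la : intpart) : schur R m la \is (sumn la).-homog.
Proof.
rewrite schurE /jacobi_trudi; apply: rpred_sum => s _.
rewrite -signr_odd rpredMsign.
set F := fun i => _; have [/forallP/= le_all|/forallPn[/= i]] :=
  boolP [forall i : 'I_(size la), (i <= nth 0%N la i + s i)%N].
  have -> : sumn la = (\sum_(i < size la) (nth 0%N la i + s i - i))%N.
    rewrite sumnB // big_split /= sumnE (big_nth 0%N) big_mkord.
    rewrite [X in (_ = _ + X - _)%N](reindex_inj (@perm_inj _ s^-1)) /=.
    by under [X in (_ = _ + X - _)%N]eq_bigr do rewrite permKV; rewrite addnK.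
  by apply: prod_homog => i; rewrite mxE /shifted le_all hsym_homog.
move=> /negbTE nle; rewrite (bigD1 i) //= mxE /shifted nle mul0r.
exact: rpred0.
Qed.

End Homogeneity.

(** One row together with one cell in each of the other rows. *)
Lemma hook_leq_sumn (la : intpart) (i : nat) : (i < size la)%N ->
  (nth 0%N la i + (size la).-1 <= sumn la)%N.
Proof.
have : 0%N \notin (la : seq nat) := intpart_pos la.
elim: (la : seq nat) i => // x s IHs i; rewrite inE negb_or => /andP[x_neq0 s0] lti.
case: i lti => [|i] lti /=.
  rewrite leq_add2l; elim: s s0 {IHs lti} => // y s IHs.
  by rewrite inE negb_or => /andP[y_neq0 /IHs] /=; lia.
by have := IHs i s0 lti; rewrite /= in lti; lia.
Qed.

Lemma eq_jacobi_trudi_low (A : comNzRingType) (g g' : nat -> A) (la : intpart) :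
    (forall r, (r <= sumn la)%N -> g r = g' r) ->
  jacobi_trudi g (size la) la = jacobi_trudi g' (size la) la.
Proof.
move=> eqg; congr (\det _); apply/matrixP => i j; rewrite !mxE /shifted.
case: leqP => // _; apply: eqg.
have := hook_leq_sumn (ltn_ord i); have := ltn_ord j; lia.
Qed.

Section CauchySeries.
Variables (B : idomainType) (m : nat) (P : {poly B}).
Hypothesis P0 : P`_0 = 1.

Let Q := map_poly (@mpolyC m B) P.

(** Being congruent to 1 in degrees below [d] is stable under products. *)
Lemma low_coef_prod d (r : 'I_m -> {mpoly B[m]}) v : (mdeg v < d)%N ->
  (\prod_(k < m) (1 + 'X_k ^+ d * r k))@_v = (1 : {mpoly B[m]})@_v.
Proof.
move: v; apply: (big_ind (fun p : {mpoly B[m]} =>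
    forall v, (mdeg v < d)%N -> p@_v = (1 : {mpoly B[m]})@_v)) => //.
  move=> p q hp hq v ltv; rewrite -[in RHS](mulr1 1) !mcoeffM.
  apply: eq_bigr => -[a b] _ /=.
  by rewrite hp ?hq // (leq_trans (bmdeg _) ltv).
move=> k _ v ltv; rewrite mcoeffD mcoeffM big1 ?addr0 // => -[a b] _ /=.
rewrite mcoeffXn; case: eqP => [eqa|_]; last by rewrite mul0r.
have := leq_ltn_trans (bmdeg a : (mdeg a <= mdeg v)%N) ltv.
by rewrite -eqa mdegMn mdeg1 mul1n ltnn.
Qed.

(** For a monomial [u] of degree [D], the determinants of [inv_coef P] and of its
    truncation [PD] agree on the partitions of [D], and [P * PD] is 1 up to
    degree [D], so that [\prod_k PD(X_k)] agrees with [X] up to that degree. *)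
Lemma Cauchy_series (X : mfps B m) :
    X * mfps_of_mpoly (\prod_(k < m) Q.['X_k]) = 1 ->
  mfps_sums_to (fun la : intpart =>
    mfps_of_mpoly ((jacobi_trudi (inv_coef P) (size la) la)%:MP * schur B m la)) X.
Proof.
move=> XQ u; pose D := mdeg u; pose PD := \poly_(r < D.+1) inv_coef P r.
have coef_mul r : (r <= D)%N -> (P * PD)`_r = (r == 0%N)%:R.
  by move=> ler; rewrite coef_mul_trunc // inv_coefP.
have PD0 : PD`_0 = 1 by have := coef_mul 0%N isT; rewrite coef0M P0 mul1r.
have coefE (la : intpart) :
    mfcoef (mfps_of_mpoly ((jacobi_trudi (inv_coef P) (size la) la)%:MP *
      schur B m la)) u =
    (jacobi_trudi (fun r => PD`_r) (size la) la *: schur B m la)@_u.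
  rewrite /= mul_mpolyC !mcoeffZ.
  have [sum_la|neq] := eqVneq (sumn la) D.
    congr (_ * _); apply: eq_jacobi_trudi_low => r; rewrite sum_la => ler.
    by rewrite coef_poly ltnS ler.
  by rewrite (dhomog_nemf_coeff (schur_homog B m la)) ?mulr0 // eq_sym.
apply: (@box_sums_to _ m D) => [la|].
  apply: contraNT; rewrite negb_and -!ltnNge => /orP[lt_size|lt_head].
    by rewrite /= schur_size0 // mulr0 mcoeff0.
  rewrite coefE mcoeffZ (dhomog_nemf_coeff (schur_homog B m la)) ?mulr0 //.
  rewrite neq_ltn; apply/orP; left; apply: leq_trans lt_head _.
  by case: (la : seq nat) => //= x s; rewrite leq_addr.
rewrite (eq_bigr _ (fun la _ => coefE la)) -raddf_sum /=.
rewrite (finite_Cauchy m PD0 (size_poly _ _)).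
pose QD := map_poly (@mpolyC m B) PD.
have [r Er] : exists r, P * PD = 1 + 'X^(D.+1) * r.
  exists (drop_poly D.+1 (P * PD)).
  rewrite -{1}[P * PD](poly_take_drop D.+1) [drop_poly _ _ * _]mulrC; congr (_ + _).
  apply/polyP => i; rewrite coef_take_poly coef1.
  case: ltnP => [lti|]; first by rewrite coef_mul.
  by case: i.
have QQD k : Q.['X_k] * QD.['X_k] =
    1 + 'X_k ^+ D.+1 * (map_poly (@mpolyC m B) r).['X_k].
  rewrite -hornerM -rmorphM Er rmorphD rmorph1 rmorphM /= map_polyXn.
  by rewrite hornerD hornerM hornerXn hornerE.
have XE : mfps_of_mpoly (\prod_(k < m) QD.['X_k]) =
    X * mfps_of_mpoly (\prod_(k < m) (1 + 'X_k ^+ D.+1 * (map_poly (@mpolyC m B) r).['X_k])).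
  rewrite -(eq_bigr _ (fun k _ => QQD k)) big_split rmorphM mulrA XQ mul1r.
  by [].
transitivity (mfcoef (mfps_of_mpoly (\prod_(k < m) QD.['X_k])) u); first by [].
rewrite XE (@mfcoef_approx _ _ D.+1 _ _ (mfps_trunc D.+1 X) 1) // => [|v ltv|v ltv].
- by rewrite mulr1 mcoeff_trunc.
- by rewrite mcoeff_trunc.
- exact: low_coef_prod.
Qed.

End CauchySeries.

(** * The six identities *)

Section ReciprocalDenominators.
Variables (C : numClosedFieldType) (N : nat).

Definition recip_denom : {poly {mpoly C[N]}} :=
  \prod_(j < N) (1 - 'X_j *: 'X + 'X^2).

Definition recip1_denom : {poly {mpoly C[N]}} := recip_denom * (1 - 'X).

Lemma map_recip_denom (A : comNzRingType) (phi : {rmorphism {mpoly C[N]} -> A}) :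
  map_poly phi recip_denom = \prod_(j < N) (1 - phi 'X_j *: 'X + 'X^2).
Proof.
rewrite rmorph_prod; apply: eq_bigr => j _.
by rewrite rmorphD rmorphB rmorph1 /= map_polyZ map_polyX map_polyXn.
Qed.

Lemma map_recip1_denom (A : comNzRingType) (phi : {rmorphism {mpoly C[N]} -> A}) :
  map_poly phi recip1_denom = map_poly phi recip_denom * (1 - 'X).
Proof. by rewrite rmorphM rmorphB rmorph1 /= map_polyX. Qed.

Lemma horner_recip_denom (A : comNzRingType) (phi : {rmorphism {mpoly C[N]} -> A}) t :
  (map_poly phi recip_denom).[t] = \prod_(j < N) (1 - phi 'X_j * t + t ^+ 2).
Proof.
by rewrite map_recip_denom horner_prod; apply: eq_bigr => j _; rewrite !hornerE.
Qed.

Lemma horner_recip1_denom (A : comNzRingType) (phi : {rmorphism {mpoly C[N]} -> A}) t :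
  (map_poly phi recip1_denom).[t] =
  (\prod_(j < N) (1 - phi 'X_j * t + t ^+ 2)) * (1 - t).
Proof. by rewrite map_recip1_denom hornerM horner_recip_denom !hornerE. Qed.

Lemma coef0_recip_denom : recip_denom`_0 = 1.
Proof.
rewrite coef0_prod big1 // => j _.
by rewrite coefD coefB coefZ coefX coefXn coef1 mulr0 subr0 addr0.
Qed.

Lemma coef0_recip1_denom : recip1_denom`_0 = 1.
Proof. by rewrite coef0M coef0_recip_denom coefB coef1 coefX subr0 mulr1. Qed.

Lemma size_recip_denom : (size recip_denom <= (N + N).+1)%N.
Proof.
apply: leq_trans (size_poly_prod_leq _ _) _.
have sz3 (j : 'I_N) : (size (1 - 'X_j *: 'X + 'X^2 : {poly {mpoly C[N]}})%R <= 3)%N.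
  apply: leq_trans (size_polyD _ _) _; rewrite size_polyXn geq_max leqnn andbT.
  apply: leq_trans (size_polyD _ _) _; rewrite size_poly1 size_polyN geq_max /=.
  by apply: leq_trans (size_scale_leq _ _) _; rewrite size_polyX.
have : (\sum_(j < N) size (1 - 'X_j *: 'X + 'X^2 : {poly {mpoly C[N]}})%R
    <= \sum_(j < N) 3)%N by apply: leq_sum => j _.
rewrite sum_nat_const card_ord leq_subLR => le_sum.
apply: leq_ltn_trans le_sum _; lia.
Qed.

Lemma size_recip1_denom : (size recip1_denom <= (N + N + 1).+1)%N.
Proof.
apply: leq_trans (size_polyMleq _ _) _.
have : (size (1 - 'X : {poly {mpoly C[N]}})%R <= 2)%N.
  by apply: leq_trans (size_polyD _ _) _; rewrite size_poly1 size_polyN size_polyX.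
have := size_recip_denom; lia.
Qed.

Lemma msymXU (s : 'S_N) j : msym s ('X_j : {mpoly C[N]}) = 'X_(s j).
Proof.
rewrite msymX; congr 'X_[_]; apply/mnmP => k.
by rewrite !mnmE -(inj_eq (@perm_inj _ s)) permKV.
Qed.

Lemma recip_denom_sym (s : 'S_N) : map_poly (msym s) recip_denom = recip_denom.
Proof.
rewrite map_recip_denom [RHS](reindex_inj (@perm_inj _ s)) /=.
by apply: eq_bigr => j _; rewrite msymXU.
Qed.

Lemma recip1_denom_sym (s : 'S_N) : map_poly (msym s) recip1_denom = recip1_denom.
Proof. by rewrite map_recip1_denom recip_denom_sym. Qed.

Variable x : 'I_N -> C.
Hypothesis x_neq0 : forall j, x j != 0.

Lemma big_recip_point (A : comNzRingType) (F : C -> A) :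
  \prod_(k < N + N) F (recip_point x k) = \prod_(j < N) (F (x j) * F (x j)^-1).
Proof.
rewrite big_split_ord big_split /= /recip_point; congr (_ * _).
  by apply: eq_bigr => j _; rewrite (unsplitK (inl _)).
by apply: eq_bigr => j _; rewrite (unsplitK (inr _)).
Qed.

Lemma big_recip1_point (A : comNzRingType) (F : C -> A) :
  \prod_(k < N + N + 1) F (recip1_point x k) =
  (\prod_(j < N) (F (x j) * F (x j)^-1)) * F 1.
Proof.
rewrite big_split_ord big_ord1 /recip1_point (unsplitK (inr _)) -big_recip_point.
by congr (_ * _); apply: eq_bigr => k _; rewrite (unsplitK (inl _)).
Qed.

Lemma recip_denom_pt :
  map_poly (meval (joukowski x)) recip_denom =
  \prod_(k < N + N) (1 - recip_point x k *: 'X).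
Proof.
rewrite map_recip_denom (big_recip_point (fun a => 1 - a *: 'X)).
apply: eq_bigr => j _; rewrite /= mevalXU /joukowski -!mul_polyC rmorphD /=.
have xV : (x j)%:P * ((x j)^-1)%:P = 1 :> {poly C} by rewrite -polyCM divff.
by ring: xV.
Qed.

Lemma recip1_denom_pt :
  map_poly (meval (joukowski x)) recip1_denom =
  \prod_(k < N + N + 1) (1 - recip1_point x k *: 'X).
Proof.
rewrite map_recip1_denom recip_denom_pt (big_recip_point (fun a => 1 - a *: 'X)).
by rewrite (big_recip1_point (fun a => 1 - a *: 'X)) scale1r.
Qed.

End ReciprocalDenominators.

Lemma sz_jacobi_trudi (C : numClosedFieldType) N (la : intpart) :
  sz C N la = jacobi_trudi (inv_coef (recip_denom C N)) (size la) la.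
Proof.
exact: (xget_specialization (coef0_recip_denom C N) (@recip_denom_sym C N)
  (@recip_denom_pt C N)).
Qed.

Lemma sz_odd_jacobi_trudi (C : numClosedFieldType) N (la : intpart) :
  sz_odd C N la = jacobi_trudi (inv_coef (recip1_denom C N)) (size la) la.
Proof.
exact: (xget_specialization (coef0_recip1_denom C N) (@recip1_denom_sym C N)
  (@recip1_denom_pt C N)).
Qed.

Section Identities.
Variables (C : numClosedFieldType) (n m : nat).
Local Notation B := {mpoly C[n]}.
Local Notation z := (@zvar C n m).
Local Notation y := (@yvar C n m).

Lemma yvarE k : y k = 'X_k.
Proof. by rewrite /yvar /in_y map_mpolyX. Qed.

Lemma horner_recip_yvar k :
  (map_poly (@mpolyC m B) (recip_denom C n)).['X_k] =
  \prod_(j < n) (1 - z j * y k + y k ^+ 2).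
Proof. by rewrite horner_recip_denom yvarE. Qed.

Lemma horner_recip1_yvar k :
  (map_poly (@mpolyC m B) (recip1_denom C n)).['X_k] =
  (\prod_(j < n) (1 - z j * y k + y k ^+ 2)) * (1 - y k).
Proof. by rewrite horner_recip1_denom yvarE. Qed.

Lemma horner_recip_oppyvar k :
  (map_poly (@mpolyC m B) (recip_denom C n)).[- y k] =
  \prod_(j < n) (1 + z j * y k + y k ^+ 2).
Proof.
by rewrite horner_recip_denom; apply: eq_bigr => j _; rewrite mulrN opprK sqrrN.
Qed.

Lemma horner_recip1_oppyvar k :
  (map_poly (@mpolyC m B) (recip1_denom C n)).[- y k] =
  (\prod_(j < n) (1 + z j * y k + y k ^+ 2)) * (1 + y k).
Proof.
rewrite map_recip1_denom hornerM horner_recip_oppyvar !hornerE opprK; by [].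
Qed.

Lemma mfps_mulVp (p : {mpoly B[m]}) : p@_0%MM = 1 ->
  (mfps_of_mpoly p)^-1 * mfps_of_mpoly p = 1.
Proof.
move=> p0; apply: mulVr; rewrite unfold_in /= /mfps_unit /= p0; exact: unitr1.
Qed.

Lemma mcoeff0_yvar k : (y k)@_0%MM = 0.
Proof. by rewrite yvarE mcoeffX mnm1_eq0. Qed.

Lemma mcoeff0_quadratic j k : (1 - z j * y k + y k ^+ 2)@_0%MM = 1.
Proof.
rewrite mcoeffD mcoeffB expr2 !(rmorphM (mcoeff 0%MM)) /= mcoeff0_yvar.
by rewrite !mulr0 subr0 addr0 mcoeff1 eqxx.
Qed.

Lemma mcoeff0_linear k : (1 - y k)@_0%MM = 1.
Proof. by rewrite mcoeffB mcoeff0_yvar subr0 mcoeff1 eqxx. Qed.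

Lemma sz_Cauchy :
  mfps_sums_to
    (fun la : intpart => mfps_of_mpoly (in_z m (sz C n la) * in_y n (schur C m la)))
    (\prod_(j < n) \prod_(k < m) (mfps_of_mpoly (1 - z j * y k + y k ^+ 2))^-1).
Proof.
under eq_fun do rewrite sz_jacobi_trudi /in_z /in_y map_schur.
apply: Cauchy_series; first exact: coef0_recip_denom.
under [X in mfps_of_mpoly X]eq_bigr do rewrite horner_recip_yvar.
rewrite exchange_big rmorph_prod -big_split big1 // => k _ /=.
rewrite rmorph_prod -big_split big1 // => j _ /=.
by rewrite mfps_mulVp ?mcoeff0_quadratic.
Qed.

Lemma sz_odd_Cauchy :
  mfps_sums_to
    (fun la : intpart => mfps_of_mpoly (in_z m (sz_odd C n la) * in_y n (schur C m la)))
    ((\prod_(j < n) \prod_(k < m) (mfps_of_mpoly (1 - z j * y k + y k ^+ 2))^-1) *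
     (\prod_(k < m) (mfps_of_mpoly (1 - y k))^-1)).
Proof.
under eq_fun do rewrite sz_odd_jacobi_trudi /in_z /in_y map_schur.
apply: Cauchy_series; first exact: coef0_recip1_denom.
under [X in mfps_of_mpoly X]eq_bigr do rewrite horner_recip1_yvar.
rewrite exchange_big rmorph_prod -big_split -big_split big1 // => k _ /=.
rewrite rmorphM mulrACA mfps_mulVp ?mcoeff0_linear // mulr1.
rewrite rmorph_prod -big_split big1 // => j _ /=.
by rewrite mfps_mulVp ?mcoeff0_quadratic.
Qed.

Lemma sz_dual_Cauchy :
  sums_to (fun la : intpart => in_z m (sz C n la) * in_y n (schur C m (conj_part la)))
    (\prod_(j < n) \prod_(k < m) (1 + z j * y k + y k ^+ 2)).
Proof.
under eq_fun do rewrite sz_jacobi_trudi.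
rewrite exchange_big; under eq_bigr do rewrite -horner_recip_oppyvar.
exact: dual_Cauchy (coef0_recip_denom C n).
Qed.

Lemma sz_odd_dual_Cauchy :
  sums_to (fun la : intpart => in_z m (sz_odd C n la) * in_y n (schur C m (conj_part la)))
    ((\prod_(j < n) \prod_(k < m) (1 + z j * y k + y k ^+ 2)) *
     (\prod_(k < m) (1 + y k))).
Proof.
under eq_fun do rewrite sz_odd_jacobi_trudi.
rewrite exchange_big -big_split /=; under eq_bigr do rewrite -horner_recip1_oppyvar.
exact: dual_Cauchy (coef0_recip1_denom C n).
Qed.

(** With [w = a + 1 / a], each factor is
    [(1 + z_j a + a^2) (1 + z_j / a + 1 / a^2) = (z_j + w)^2]. *)
Lemma horner_recip_pair (a : C) : a != 0 ->
  (recip_denom C n).[- a%:MP] * (recip_denom C n).[- (a^-1)%:MP] =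
  \prod_(j < n) ('X_j + (a + a^-1)%:MP) ^+ 2.
Proof.
move=> a_neq0; have aV : a%:MP * (a^-1)%:MP = 1 :> B by rewrite -mpolyCM divff.
have := horner_recip_denom (idfun : {rmorphism B -> B}).
rewrite map_poly_id // => hE; rewrite !hE -big_split; apply: eq_bigr => j _ /=.
rewrite mpolyCD; ring: aV.
Qed.

Lemma sz_sz_Cauchy :
  sums_to (fun la : intpart => in_z m (sz C n la) * in_y n (sz C m (conj_part la)))
    (\prod_(j < n) \prod_(k < m) (z j + y k) ^+ 2).
Proof.
under eq_fun do rewrite !sz_jacobi_trudi.
apply: (dual_Cauchy_specialized (coef0_recip_denom C n) (coef0_recip_denom C m)
  (size_recip_denom C m) (@recip_denom_pt C m)) => x x_neq0.
rewrite (big_recip_point _ (fun a => (recip_denom C n).[- a%:MP])).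
rewrite exchange_big rmorph_prod; apply: eq_bigr => k _.
rewrite horner_recip_pair // rmorph_prod; apply: eq_bigr => j _ /=.
by rewrite rmorphXn rmorphD /= mevalC yvarE mevalXU.
Qed.

Lemma sz_odd_sz_odd_Cauchy :
  sums_to
    (fun la : intpart => in_z m (sz_odd C n la) * in_y n (sz_odd C m (conj_part la)))
    (2 * (\prod_(j < n) \prod_(k < m) (z j + y k) ^+ 2) *
     (\prod_(j < n) (2 + z j)) * (\prod_(k < m) (2 + y k))).
Proof.
under eq_fun do rewrite !sz_odd_jacobi_trudi.
apply: (dual_Cauchy_specialized (coef0_recip1_denom C n) (coef0_recip1_denom C m)
  (size_recip1_denom C m) (@recip1_denom_pt C m)) => x x_neq0.
rewrite (big_recip1_point _ (fun a => (recip1_denom C n).[- a%:MP])).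
have hornerE1 t : (recip1_denom C n).[t] = (recip_denom C n).[t] * (1 - t).
  by rewrite hornerM !hornerE.
have -> : (recip1_denom C n).[- 1%:MP] = 2 * \prod_(j < n) (2 + 'X_j).
  have := horner_recip_denom (idfun : {rmorphism B -> B}).
  rewrite map_poly_id // hornerE1 mpolyC1 => ->; rewrite opprK mulrC.
  by congr (_ * _); apply: eq_bigr => j _ /=; ring.
have pairE a : a != 0 ->
    (recip1_denom C n).[- a%:MP] * (recip1_denom C n).[- (a^-1)%:MP] =
    (\prod_(j < n) ('X_j + (a + a^-1)%:MP) ^+ 2) * (2 + (a + a^-1)%:MP).
  move=> a_neq0; have aV : a%:MP * (a^-1)%:MP = 1 :> B by rewrite -mpolyCM divff.
  rewrite !hornerE1 mulrACA horner_recip_pair //; congr (_ * _).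
  by rewrite mpolyCD; ring: aV.
rewrite (eq_bigr _ (fun k _ => pairE (x k) (x_neq0 k))) big_split /=.
rewrite !mevalM rmorph_nat !rmorph_prod /=.
have -> : \prod_(j < n) (\prod_(k < m) (z j + y k) ^+ 2).@[fun k => (joukowski x k)%:MP]
    = \prod_(k < m) \prod_(j < n) ('X_j + (joukowski x k)%:MP) ^+ 2.
  rewrite exchange_big; apply: eq_bigr => j _ /=.
  rewrite rmorph_prod; apply: eq_bigr => k _ /=.
  by rewrite rmorphXn rmorphD /= mevalC yvarE mevalXU.
have -> : \prod_(j < n) (2 + z j).@[fun k => (joukowski x k)%:MP]
    = \prod_(j < n) (2 + 'X_j).
  by apply: eq_bigr => j _; rewrite mevalD rmorph_nat mevalC.
have -> : \prod_(k < m) (2 + y k).@[fun k => (joukowski x k)%:MP]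
    = \prod_(k < m) (2 + (joukowski x k)%:MP).
  by apply: eq_bigr => k _; rewrite mevalD rmorph_nat yvarE mevalXU.
rewrite /joukowski; ring.
Qed.

End Identities.

Theorem theorem1p9 (R : realType) (n m : nat) (hn : (1 <= n)%N) (hm : (1 <= m)%N) :
  let C : numClosedFieldType := R[i] in
  let z : 'I_n -> {mpoly {mpoly C[n]}[m]} := @zvar C n m in
  let y : 'I_m -> {mpoly {mpoly C[n]}[m]} := @yvar C n m in
  let sz_z la := in_z m (sz C n la) in
  let sz_y la := in_y n (sz C m la) in
  let sz_odd_z la := in_z m (sz_odd C n la) in
  let sz_odd_y la := in_y n (sz_odd C m la) in
  let s_y la := in_y n (schur C m la) in
  mfps_sums_to
    (fun la : intpart => mfps_of_mpoly (sz_z la * s_y la))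
    (\prod_(j < n) \prod_(k < m)
       (mfps_of_mpoly (1 - z j * y k + y k ^+ 2))^-1) /\
  sums_to
    (fun la : intpart => sz_z la * s_y (conj_part la))
    (\prod_(j < n) \prod_(k < m) (1 + z j * y k + y k ^+ 2)) /\
  sums_to
    (fun la : intpart => sz_z la * sz_y (conj_part la))
    (\prod_(j < n) \prod_(k < m) (z j + y k) ^+ 2) /\
  mfps_sums_to
    (fun la : intpart => mfps_of_mpoly (sz_odd_z la * s_y la))
    ((\prod_(j < n) \prod_(k < m)
        (mfps_of_mpoly (1 - z j * y k + y k ^+ 2))^-1) *
     (\prod_(k < m) (mfps_of_mpoly (1 - y k))^-1)) /\
  sums_to
    (fun la : intpart => sz_odd_z la * s_y (conj_part la))
    ((\prod_(j < n) \prod_(k < m) (1 + z j * y k + y k ^+ 2)) *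
     (\prod_(k < m) (1 + y k))) /\
  sums_to
    (fun la : intpart => sz_odd_z la * sz_odd_y (conj_part la))
    (2 * (\prod_(j < n) \prod_(k < m) (z j + y k) ^+ 2) *
     (\prod_(j < n) (2 + z j)) * (\prod_(k < m) (2 + y k))).
Proof.
split; first exact: sz_Cauchy.
split; first exact: sz_dual_Cauchy.
split; first exact: sz_sz_Cauchy.
split; first exact: sz_odd_Cauchy.
split; first exact: sz_odd_dual_Cauchy.
exact: sz_odd_sz_odd_Cauchy.
Qed.
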